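(* Suppose $\mathcal{A}_I$ and $\mathcal{B}_J$ are objects in $\mathbf{PQBunC^*Alg}_{\mathcal{I}_1}$ and $\sigma:\mathcal{A}_I\to\mathcal{B}_J$ is a morphism in this category (in particular, smooth and second-order). Then $L_P(\sigma)$ is a morphism in $\mathbf{Class}$ (i.e., it restricts to a Poisson morphism). Hence, $L_P$ is a functor from $\mathbf{PQBunC^*Alg}_{\mathcal{I}_1}$ to $\mathbf{Class}$.
   Context: For a metric space $I$, $UC_b(I)$ is the C*-algebra of bounded uniformly continuous functions $I\to\mathbb{C}$. C*-algebras are not assumed unital. A $UC_b$ bundle of C*-algebras over a metric space $I$, written $((\mathfrak{A}_\hbar,\phi^I_\hbar)_{\hbar\in I},\mathfrak{A})$, is a family of C*-algebras $(\mathfrak{A}_\hbar)_{\hbar\in I}$, a C*-algebra $\mathfrak{A}$, and *-homomorphisms $\phi^I_\hbar:\mathfrak{A}\to\mathfrak{A}_\hbar$ such that: (i) each $\phi^I_\hbar$ is surjective and $\|a\|=\sup_{\hbar\in I}\|\phi^I_\hbar(a)\|_\hbar$ for all $a\in\mathfrak{A}$; (ii) for each $f\in UC_b(I)$ and $a\in\mathfrak{A}$ there is an element $fa\in\mathfrak{A}$ with $\phi^I_\hbar(fa)=f(\hbar)\phi^I_\hbar(a)$ for all $\hbar\in I$; (iii) for each $a\in\mathfrak{A}$, the function $\hbar\mapsto\|\phi^I_\hbar(a)\|_\hbar$ is in $UC_b(I)$. A homomorphism from $\mathcal{A}_I=((\mathfrak{A}_\hbar,\phi^I_\hbar)_{\hbar\in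 I},\mathfrak{A})$ to $\mathcal{B}_J=((\mathfrak{B}_\hbar,\phi^J_\hbar)_{\hbar\in J},\mathfrak{B})$ is a pair $\sigma=(\alpha,\beta)$ where $\alpha:I\to J$ is a metric map (i.e. $d_J(\alpha(x),\alpha(y))\le d_I(x,y)$), $\beta:\mathfrak{A}\to\mathfrak{B}$ is a *-homomorphism, and for all $a_1,a_2\in\mathfrak{A}$, $\hbar\in I$: if $\phi^I_\hbar(a_1)=\phi^I_\hbar(a_2)$, then $\phi^J_{\alpha(\hbar)}(\beta(a_1))=\phi^J_{\alpha(\hbar)}(\beta(a_2))$. Composition is componentwise. $\mathcal{I}_1$ is the collection of all locally compact, non-compact metric spaces $I$ whose one-point compactification $\dot I=I\cup\{0_I\}$ is metrizable by a metric for which the canonical embedding $\alpha_I:I\to\dot I$ is isometric; $C_1(I):=\dot I$ with this metric, and $|\hbar|_I:=d_{C_1(I)}(\alpha_I(\hbar),0_I)$ for $\hbar\in I$. For a $UC_b$ bundle $\mathcal{A}_I$ with $I\in\mathcal{I}_1$, its minimal extension to $C_1(I)$ is the $UC_b$ bundle $((\mathfrak{A}/\mathcal{K}_j,\phi^{C_1(I)}_j)_{j\in C_1(I)},\mathfrak{A})$, where $\mathcal{K}_j$ is the closed two-sided ideal of all $a\in\mathfrak{A}$ such that $\lim_\delta\|\phi^I_{i_\delta}(a)\|_{i_\delta}=0$ for every net $\{i_\delta\}$ in $I$ with $\alpha_I(i_\delta)\to j$, and $\phi^{C_1(I)}_j$ is the quotient map. Put $L(\mathcal{A}_I)=\mathfrak{A}_0:=\mathfrak{A}/\mathcal{K}_{0_I}$.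 For a homomorphism $\sigma=(\alpha,\beta):\mathcal{A}_I\to\mathcal{B}_J$ with $\alpha$ proper (preimages of compact sets are compact), $L(\sigma)=\sigma_0:\mathfrak{A}_0\to\mathfrak{B}_0$ is the *-homomorphism $\sigma_0(\phi^{C_1(I)}_{0_I}(a)):=\phi^{C_1(J)}_{0_J}(\beta(a))$, $a\in\mathfrak{A}$. A post-quantization bundle is a $UC_b$ bundle $\mathcal{A}_I=((\mathfrak{A}_\hbar,\phi^I_\hbar)_{\hbar\in I},\mathfrak{A})$ over $I\in\mathcal{I}_1$ together with a subalgebra $P_{\mathcal{A}}\subseteq\mathfrak{A}$ such that: (i) $P_{\mathcal{A}}$ is norm dense in $\mathfrak{A}$; (ii) for each pair $a,b\in P_{\mathcal{A}}$ there is $c_{a,b}\in P_{\mathcal{A}}$ with $\phi^I_\hbar(c_{a,b})=\frac{i}{|\hbar|_I}[\phi^I_\hbar(a),\phi^I_\hbar(b)]$ for all $\hbar\in I$; (iii) for each pair $a,b\in\mathfrak{A}$, $\lim_{\hbar\to0_I}\|[\phi^I_\hbar(a),\phi^I_\hbar(b)]\|=0$. Given a post-quantization bundle, a Poisson bracket $\{\cdot,\cdot\}_{\mathcal{A}}$ is defined on the dense subset $\phi^{C_1(I)}_{0_I}[P_{\mathcal{A}}]\subseteq\mathfrak{A}_0$ by $\{\phi^{C_1(I)}_{0_I}(a),\phi^{C_1(I)}_{0_I}(b)\}_{\mathcal{A}}:=\phi^{C_1(I)}_{0_I}(c_{a,b})$ for $a,b\in P_{\mathcal{A}}$. A homomorphism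 $\sigma=(\alpha,\beta):\mathcal{A}_I\to\mathcal{B}_J$ between post-quantization bundles is smooth if $\beta[P_{\mathcal{A}}]\subseteq P_{\mathcal{B}}$, and second-order if there is a constant $K\ge0$ such that $\left|\frac{1}{|\hbar|_I}-\frac{1}{|\alpha(\hbar)|_J}\right|\to K$ as $\hbar\to0_I$. $\mathbf{PQBunC^*Alg}_{\mathcal{I}_1}$ has as objects the post-quantization bundles with base space in $\mathcal{I}_1$ and as morphisms the smooth, second-order homomorphisms whose map between base spaces is proper. $\mathbf{Class}$ has as objects the pairs $(\mathfrak{A}_0,(P^0_{\mathcal{A}},\{\cdot,\cdot\}_{\mathcal{A}}))$, where $\mathfrak{A}_0$ is a commutative C*-algebra and $P^0_{\mathcal{A}}\subseteq\mathfrak{A}_0$ is a norm-dense Poisson algebra with bracket $\{\cdot,\cdot\}_{\mathcal{A}}$; morphisms are *-homomorphisms $\sigma_0:\mathfrak{A}_0\to\mathfrak{B}_0$ such that $\sigma_0[P^0_{\mathcal{A}}]\subseteq P^0_{\mathcal{B}}$ and $\{\sigma_0(A),\sigma_0(B)\}_{\mathcal{B}}=\sigma_0(\{A,B\}_{\mathcal{A}})$ for all $A,B\in P^0_{\mathcal{A}}$. $L_P$ is defined on objects by $(\mathcal{A}_I,P_{\mathcal{A}})\mapsto(L(\mathcal{A}_I),(\phi^{C_1(I)}_{0_I}[P_{\mathcal{A}}],\{\cdot,\cdot\}_{\mathcal{A}}))$ and on morphisms by $\sigma\mapsto L(\sigma)=\sigma_0$.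
   Formalization: The subalgebra P_A of a post-quantization bundle is taken to be closed under the involution (a *-subalgebra); for a subalgebra that is only linear and multiplicative the Poisson bracket on the limit algebra can depend on the chosen representatives. *)

(* Defs.v *)
From HB Require Import structures.
From mathcomp Require Import all_boot all_order all_algebra.
From mathcomp Require Import all_classical all_reals all_analysis.
From mathcomp Require Import complex.
Set Implicit Arguments.
Unset Strict Implicit.
Unset Printing Implicit Defensive.
Import Order.TTheory GRing.Theory Num.Theory.
Import numFieldNormedType.Exports.
Local Open Scope classical_set_scope.
Local Open Scope quotient_scope.
Local Open Scope complex_scope.
Local Open Scope ring_scope.

Record starAlg (R : realType) := StarAlg {
  sa_car :> normedModType R[i];
  sa_mul : sa_car -> sa_car -> sa_car;
  sa_star : sa_car -> sa_car
}.
Arguments sa_mul {R s}.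
Arguments sa_star {R s}.

Notation "x ** y" := (sa_mul x y) (at level 40, left associativity).
Notation "x ^†" := (sa_star x) (at level 2, format "x ^†").

Definition commutator (R : realType) (A : starAlg R) (a b : A) : A :=
  a ** b - b ** a.

(* No unit is required.  The norm of a [normedModType R[i]] takes its values
   in the nonnegative reals of R[i]. *)
Record is_cstar (R : realType) (A : starAlg R) : Prop := IsCstar {
  cs_complete : forall F : set_system A, ProperFilter F -> cauchy F -> cvg F;
  cs_mulA : forall a b c : A, a ** (b ** c) = (a ** b) ** c;
  cs_mulDl : forall a b c : A, (a + b) ** c = a ** c + b ** c;
  cs_mulDr : forall a b c : A, a ** (b + c) = a ** b + a ** c;
  cs_scaleAl : forall (k : R[i]) (a b : A), (k *: a) ** b = k *: (a ** b);
  cs_scaleAr : forall (k : R[i]) (a b : A), a ** (k *: b) = k *: (a ** b);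
  cs_starD : forall a b : A, (a + b)^† = a^† + b^†;
  cs_starZ : forall (k : R[i]) (a : A), (k *: a)^† = k^* *: a^†;
  cs_starK : forall a : A, a^†^† = a;
  cs_starM : forall a b : A, (a ** b)^† = b^† ** a^†;
  cs_normM : forall a b : A, `|a ** b| <= `|a| * `|b|;
  cs_norm_star : forall a : A, `|a^† ** a| = `|a| ^+ 2
}.

Record cstarAlg (R : realType) := CstarAlg {
  cs_alg :> starAlg R;
  cs_axioms : is_cstar cs_alg
}.

Record is_starhom (R : realType) (A B : starAlg R) (f : A -> B) : Prop :=
  IsStarHom {
  sh_linear : linear f;
  sh_mul : forall a b : A, f (a ** b) = f a ** f b;
  sh_star : forall a : A, f a^† = (f a)^†
}.

Record is_starsubalg (R : realType) (A : starAlg R) (P : set A) : Prop :=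
  IsStarSubalg {
  ssa0 : P 0;
  ssaD : forall a b, P a -> P b -> P (a + b);
  ssaZ : forall (k : R[i]) a, P a -> P (k *: a);
  ssaM : forall a b, P a -> P b -> P (a ** b);
  ssa_star : forall a, P a -> P a^†
}.

Record closed_ideal (R : realType) (A : starAlg R) := ClosedIdeal {
  ci_set :> A -> Prop;
  ci0 : ci_set 0;
  ciD : forall a b, ci_set a -> ci_set b -> ci_set (a + b);
  ciZ : forall (k : R[i]) a, ci_set a -> ci_set (k *: a);
  ciMl : forall a b, ci_set b -> ci_set (a ** b);
  ciMr : forall a b, ci_set a -> ci_set (a ** b);
  ci_closed : closed ci_set
}.

Section quotient.
Variables (R : realType) (A : starAlg R) (K : closed_ideal A).

Let KN a : K a -> K (- a).
Proof. by move=> Ka; rewrite -scaleN1r; exact: ciZ. Qed.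

Definition qrel (x y : A) : bool := `[< K (x - y) >].

Let qrel_refl : reflexive qrel.
Proof. by move=> x; apply/asboolP; rewrite subrr; exact: ci0. Qed.

Let qrel_sym : symmetric qrel.
Proof.
move=> x y; apply/asboolP/asboolP => /KN; by rewrite opprB.
Qed.

Let qrel_trans : transitive qrel.
Proof.
move=> y x z /asboolP xy /asboolP yz; apply/asboolP.
by rewrite -(subrK y x) -addrA; exact: ciD.
Qed.

Canonical qrel_equiv := EquivRel qrel qrel_refl qrel_sym qrel_trans.

Definition quot : Type := {eq_quot qrel}.
HB.instance Definition _ := Choice.on quot.

Definition qpi (a : A) : quot := \pi_({eq_quot qrel}) a.
Definition qrepr (x : quot) : A := repr (x : {eq_quot qrel}).

Lemma qreprK x : qpi (qrepr x) = x.
Proof. exact: (@reprK _ {eq_quot qrel}). Qed.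

Lemma qpi_eq a b : qpi a = qpi b <-> K (a - b).
Proof.
split=> [/eqmodP/asboolP //|Kab].
by apply/eqmodP/asboolP.
Qed.

Lemma qreprP a : K (qrepr (qpi a) - a).
Proof. by apply/qpi_eq; rewrite qreprK. Qed.

Definition qzero := qpi 0.
Definition qopp x := qpi (- qrepr x).
Definition qadd x y := qpi (qrepr x + qrepr y).
Definition qscale (k : R[i]) x := qpi (k *: qrepr x).

Let qpiD a b : qpi (a + b) = qadd (qpi a) (qpi b).
Proof.
apply/qpi_eq; rewrite opprD addrACA.
by apply: ciD; rewrite -opprB; apply: KN; exact: qreprP.
Qed.

Let qpiN a : qpi (- a) = qopp (qpi a).
Proof.
by apply/qpi_eq; rewrite opprK addrC; exact: qreprP.
Qed.

Let qpiZ k a : qpi (k *: a) = qscale k (qpi a).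
Proof.
apply/qpi_eq; rewrite -scalerBr; apply: ciZ.
by rewrite -opprB; apply: KN; exact: qreprP.
Qed.

Let qaddA : associative qadd.
Proof.
move=> x y z; rewrite -[x]qreprK -[y]qreprK -[z]qreprK.
by rewrite -!qpiD addrA.
Qed.

Let qaddC : commutative qadd.
Proof. by move=> x y; rewrite /qadd addrC. Qed.

Let qadd0 : left_id qzero qadd.
Proof. by move=> x; rewrite -[x]qreprK -qpiD add0r. Qed.

Let qaddN : left_inverse qzero qopp qadd.
Proof. by move=> x; rewrite -[x]qreprK -qpiN -qpiD addNr. Qed.

HB.instance Definition _ :=
  GRing.isZmodule.Build quot qaddA qaddC qadd0 qaddN.

Let qscaleA k l x : qscale k (qscale l x) = qscale (k * l) x.
Proof. by rewrite -[x]qreprK -!qpiZ scalerA. Qed.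

Let qscale1 : left_id 1 qscale.
Proof. by move=> x; rewrite -[x]qreprK -qpiZ scale1r. Qed.

Let qscaleDr : right_distributive qscale +%R.
Proof.
move=> k x y; rewrite -[x]qreprK -[y]qreprK.
by rewrite -[_ + _]qpiD -!qpiZ scalerDr qpiD.
Qed.

Let qscaleDl x : {morph qscale^~ x : k l / k + l}.
Proof. by move=> k l; rewrite -[x]qreprK -!qpiZ scalerDl qpiD. Qed.

HB.instance Definition _ :=
  GRing.Zmodule_isLmodule.Build R[i] quot qscaleA qscale1 qscaleDr qscaleDl.

Definition qnorm_set (x : quot) : set R :=
  [set complex.Re `|a| | a in [set a | qpi a = x]].

Definition qnorm (x : quot) : R[i] := (inf (qnorm_set x))%:C.

Let Rnorm (V : normedModType R[i]) (v : V) : (complex.Re `|v|)%:C = `|v|.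
Proof. by rewrite RRe_real// normr_real. Qed.

Let Rnorm_ge0 (V : normedModType R[i]) (v : V) : 0 <= complex.Re `|v|.
Proof. by rewrite -lecR Rnorm normr_ge0. Qed.

Let qset_inf x : has_inf (qnorm_set x).
Proof.
split; first by exists (complex.Re `|qrepr x|), (qrepr x) => //=; rewrite qreprK.
by exists 0 => _ [a _ <-]; exact: Rnorm_ge0.
Qed.

Let qinf_ge0 x : 0 <= inf (qnorm_set x).
Proof.
apply: lb_le_inf; first by have [] := qset_inf x.
by move=> _ [a _ <-]; exact: Rnorm_ge0.
Qed.

Let qinf_le a : inf (qnorm_set (qpi a)) <= complex.Re `|a|.
Proof. by apply: ge_inf; [have [] := qset_inf (qpi a)|exists a]. Qed.

Let qnormD x y : qnorm (x + y) <= qnorm x + qnorm y.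
Proof.
rewrite /qnorm -rmorphD lecR; apply/ler_addgt0Pr => e e0.
have e20 : 0 < e / 2 by rewrite divr_gt0.
have [_ [a <- <-] ha] := inf_adherent e20 (qset_inf x).
have [_ [b <- <-] hb] := inf_adherent e20 (qset_inf y).
rewrite -[_ + _ : quot]qpiD; apply: (le_trans (qinf_le _)).
rewrite [leRHS](_ : _ = (inf (qnorm_set (qpi a)) + e / 2)
    + (inf (qnorm_set (qpi b)) + e / 2)); last first.
  by rewrite addrACA -splitr.
apply: le_trans (lerD (ltW ha) (ltW hb)).
by rewrite -lecR rmorphD /= !Rnorm ler_normD.
Qed.

Let qnormZ_le (k : R[i]) x : qnorm (k *: x) <= `|k| * qnorm x.
Proof.
have [->|k0] := eqVneq k 0.
  rewrite normr0 mul0r /qnorm scale0r -[0]/(qpi 0) lecR.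
  by apply: (le_trans (qinf_le 0)); rewrite normr0.
have nk0 : 0 < complex.Re `|k|.
  by rewrite -ltcR RRe_real ?normr_real// normr_gt0.
rewrite /qnorm -[`|k|]RRe_real ?normr_real// -rmorphM lecR.
rewrite -ler_pdivrMl//; apply: lb_le_inf; first by have [] := qset_inf x.
move=> _ [a <- <-]; rewrite ler_pdivrMl// -[_ *: _]qpiZ.
apply: (le_trans (qinf_le _)).
by rewrite -lecR rmorphM /= !Rnorm ?RRe_real ?normr_real// normrZ.
Qed.

Let qnormZ (k : R[i]) x : qnorm (k *: x) = `|k| * qnorm x.
Proof.
apply/eqP; rewrite eq_le qnormZ_le /=.
have [->|k0] := eqVneq k 0.
  by rewrite normr0 mul0r /qnorm lecR.
rewrite -ler_pdivlMl ?normr_gt0// -normfV.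
apply: le_trans (qnormZ_le _ _).
by rewrite scalerA mulVf// scale1r.
Qed.

Let qnorm0 x : qnorm x = 0 -> x = 0.
Proof.
move=> x0; have {x0} i0 : inf (qnorm_set x) = 0.
  by move: x0; rewrite /qnorm => /(congr1 (@complex.Re R)).
rewrite -[x]qreprK -[0]/(qpi 0); apply/qpi_eq; rewrite subr0.
apply: (@ci_closed _ _ K) => B /nbhs_ballP[e /= e0 eB].
have rpos : 0 < complex.Re e.
  by move: e0; rewrite ltcE/= => /andP[].
have [_ [a ax <-]] := inf_adherent rpos (qset_inf x).
rewrite i0 add0r => ae; exists (qrepr x - a); split.
  by apply/qpi_eq; rewrite qreprK ax.
apply: eB; rewrite -ball_normE /= opprB addrC subrK.
rewrite -Rnorm -(@RRe_real _ e) ?gtr0_real// ltcR //.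
Qed.

HB.instance Definition _ :=
  Lmodule_isNormed.Build R[i] quot qnormD qnormZ qnorm0.

Definition qmul (x y : quot) : quot := qpi (qrepr x ** qrepr y).
Definition qstar (x : quot) : quot := qpi (qrepr x)^†.

Definition quotAlg : starAlg R := @StarAlg R quot qmul qstar.

End quotient.

Definition UCb (R : realType) (I : metricType R) (f : I -> R[i]) : Prop :=
  unif_continuous (f : I -> (R[i])^o) /\ exists M : R[i], forall x, `|f x| <= M.

Record ucb_bundle (R : realType) (I : metricType R) := UCbBundle {
  fib : I -> cstarAlg R;
  sec : cstarAlg R;
  phi : forall h : I, sec -> fib h;
  phi_starhom : forall h : I, is_starhom (phi h);
  phi_surj : forall (h : I) (b : fib h), exists a : sec, phi h a = b;
  phi_norm : forall a : sec, supremums (range (fun h : I => `|phi h a|)) `|a|;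
  ucb_act : forall (f : I -> R[i]) (a : sec), UCb f ->
    exists fa : sec, forall h : I, phi h fa = f h *: phi h a;
  ucb_norm : forall a : sec, UCb (fun h : I => `|phi h a|)
}.
Arguments phi {R I} u h.

Section base_spaces.
Variable R : realType.

Definition is_C1_dist (I : metricType R)
    (d : one_point_compactification I -> one_point_compactification I -> R) :
    Prop :=
  [/\ forall x y, 0 <= d x y,
      forall x y, d x y = 0 <-> x = y,
      forall x y, d x y = d y x,
      forall x y z, d x z <= d x y + d y z &
      forall x, nbhs x = filter_from [set e : R | 0 < e]
                                     (fun e => [set y | d x y < e])]
  /\ forall x y : I, d (Some x) (Some y) = mdist x y.

Definition in_I1 (I : metricType R) : Prop :=
  [/\ locally_compact [set: I], ~ compact [set: I] &
      exists d, is_C1_dist (I := I) d].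

Record I1space := I1Space {
  I1_sort :> metricType R;
  I1P : in_I1 I1_sort
}.

(* The metric on the one-point compactification is unique, being continuous
   and prescribed on the dense subspace I; hence nothing depends on the
   choice made here. *)
Definition C1_dist (I : I1space) :
    one_point_compactification I -> one_point_compactification I -> R :=
  let: And3 _ _ ex := I1P I in sval (cid ex).

Lemma C1_distP (I : I1space) : is_C1_dist (@C1_dist I).
Proof. by rewrite /C1_dist; case: (I1P I) => ? ? ex; exact: (svalP (cid ex)). Qed.

Definition zeroI (I : I1space) : one_point_compactification I := None.

Definition absI (I : I1space) (h : I) : R := C1_dist (Some h) (zeroI I).

(* The filter on I of the limits "as h tends to 0_I". *)
Definition at0 (I : I1space) : set_system I :=
  filter_from (nbhs (zeroI I)) (fun U => Some @^-1` U).

End base_spaces.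
Arguments zeroI {R} I.
Arguments at0 {R} I.

Definition directed_set (D : Type) (le : D -> D -> Prop) : Prop :=
  [/\ inhabited D, forall d, le d d,
      forall d e f, le d e -> le e f -> le d f &
      forall d e, exists f, le d f /\ le e f].

(* The filter of tails, along which the convergence of a net indexed by
   (D, le) is taken. *)
Definition tails (D : Type) (le : D -> D -> Prop) : set_system D :=
  filter_from [set: D] (fun d => [set e | le d e]).

Lemma tails_filter (D : Type) (le : D -> D -> Prop) :
  directed_set le -> ProperFilter (tails le).
Proof.
case=> [[d0] lexx le_trans dir]; apply: filter_from_proper; last first.
  by move=> d _; exists d; exact: lexx.
apply: filter_from_filter; first by exists d0.
move=> d e _ _; have [f [df ef]] := dir d e.
by exists f => // x fx; split; [exact: le_trans fx|exact: le_trans fx].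
Qed.

Section minimal_extension.
Variables (R : realType) (I : I1space R) (A : ucb_bundle I).

Definition minext_set (j : one_point_compactification I) : set (sec A) :=
  [set a | forall (D : Type) (le : D -> D -> Prop), directed_set le ->
     forall i : D -> I,
     (fun d => Some (i d) : one_point_compactification I) @ tails le --> j ->
     (fun d => `|phi A (i d) a| : (R[i])^o) @ tails le --> (0 : (R[i])^o)].

Let phi_le h a : `|phi A h a| <= `|a|.
Proof. by have [+ _] := phi_norm a; apply; exists h. Qed.

Let minextP j a : minext_set j a <->
  forall (D : Type) (le : D -> D -> Prop), directed_set le ->
    forall i : D -> I,
    (fun d => Some (i d) : one_point_compactification I) @ tails le --> j ->
    forall e : R[i], 0 < e -> \forall d \near tails le, `|phi A (i d) a| < e.
Proof.
split=> h D le Dle i ij; have FF := tails_filter Dle.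
- move=> e e0; have /cvgrPdist_lt/(_ _ e0) := h D le Dle i ij.
  by apply: filterS => d; rewrite sub0r normrN normr_id.
- apply/cvgrPdist_lt => e e0; have := h D le Dle i ij e e0.
  by apply: filterS => d; rewrite sub0r normrN normr_id.
Qed.

Let minext0 j : minext_set j 0.
Proof.
apply/minextP => D le Dle i _ e e0; have FF := tails_filter Dle.
apply: nearW => d; have := phi_le (i d) 0; rewrite normr0 => /le_lt_trans.
exact.
Qed.

Let minextD j a b : minext_set j a -> minext_set j b -> minext_set j (a + b).
Proof.
move=> /minextP ha /minextP hb; apply/minextP => D le Dle i ij e e0.
have FF := tails_filter Dle; have e20 : 0 < e / 2 by rewrite divr_gt0.
apply: filterS2 (ha D le Dle i ij _ e20) (hb D le Dle i ij _ e20) => d da db.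
have [lin _ _] := phi_starhom A (i d).
have -> : phi A (i d) (a + b) = phi A (i d) a + phi A (i d) b.
  by have := lin 1 a b; rewrite !scale1r.
by rewrite (le_lt_trans (ler_normD _ _))// [e]splitr ltrD.
Qed.

Let minext_scaled j a b (C : R[i]) : 0 <= C ->
  (forall h, `|phi A h b| <= C * `|phi A h a|) ->
  minext_set j a -> minext_set j b.
Proof.
move=> C0 hb /minextP ha; apply/minextP => D le Dle i ij e e0.
have FF := tails_filter Dle.
have C10 : 0 < C + 1 by rewrite ltr_wpDl.
have eC : 0 < e / (C + 1) by rewrite divr_gt0.
have := ha D le Dle i ij _ eC; apply: filterS => d da.
apply: (le_lt_trans (hb _)).
apply: (@le_lt_trans _ _ ((C + 1) * `|phi A (i d) a|)).
  by rewrite ler_wpM2r// lerDl.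
by rewrite mulrC -ltr_pdivlMr.
Qed.

Let minextZ j (k : R[i]) a : minext_set j a -> minext_set j (k *: a).
Proof.
apply: (@minext_scaled _ _ _ `|k|) => // h.
have [lin _ _] := phi_starhom A h.
have p0 : phi A h 0 = 0.
  by have := lin (- 1) 0 0; rewrite scaler0 addr0 scaleN1r addNr.
by have := lin k a 0; rewrite !addr0 p0 addr0 => ->; rewrite normrZ.
Qed.

Let minextMl j a b : minext_set j b -> minext_set j (a ** b).
Proof.
apply: (@minext_scaled _ _ _ `|a|) => // h.
rewrite (sh_mul (phi_starhom A h)).
apply: (le_trans (cs_normM (cs_axioms (fib A h)) _ _)).
by rewrite ler_wpM2r.
Qed.

Let minextMr j a b : minext_set j a -> minext_set j (a ** b).
Proof.
apply: (@minext_scaled _ _ _ `|b|) => // h.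
rewrite (sh_mul (phi_starhom A h)).
apply: (le_trans (cs_normM (cs_axioms (fib A h)) _ _)).
by rewrite mulrC ler_wpM2r.
Qed.

Let minext_closed j : closed (minext_set j).
Proof.
move=> a cla; apply/minextP => D le Dle i ij e e0.
have FF := tails_filter Dle; have e20 : 0 < e / 2 by rewrite divr_gt0.
have [b [/minextP hb]] := cla _ (nbhsx_ballx a _ e20).
rewrite -ball_normE /= => ab.
have := hb D le Dle i ij _ e20; apply: filterS => d db.
have [lin _ _] := phi_starhom A (i d).
have E : phi A (i d) a = phi A (i d) (a - b) + phi A (i d) b.
  by have := lin 1 (a - b) b; rewrite !scale1r subrK.
rewrite E (le_lt_trans (ler_normD _ _))// [e]splitr ltrD//.
exact: le_lt_trans (phi_le _ _) ab.
Qed.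

Definition minext_ideal (j : one_point_compactification I) :
    closed_ideal (sec A) :=
  ClosedIdeal (@minext0 j) (@minextD j) (@minextZ j) (@minextMl j)
    (@minextMr j) (@minext_closed j).

Definition minext_fib (j : one_point_compactification I) : starAlg R :=
  quotAlg (minext_ideal j).

Definition minext_phi (j : one_point_compactification I) :
    sec A -> minext_fib j := @qpi _ _ (minext_ideal j).

Definition Lim : starAlg R := minext_fib (zeroI I).
Definition phi0 : sec A -> Lim := minext_phi (zeroI I).

End minimal_extension.
Arguments phi0 {R I} A.

Definition scaled_commutator (R : realType) (I : I1space R)
    (A : ucb_bundle I) (a b c : sec A) : Prop :=
  forall h : I,
    phi A h c = ('i / (absI h)%:C) *: commutator (phi A h a) (phi A h b).

(* The subalgebra is a *-subalgebra, as usual for subalgebras of C*-algebras;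
   this is what makes the Poisson bracket below independent of the choice of
   representatives. *)
Record pqBundle (R : realType) := PQBundle {
  pq_base : I1space R;
  pq_bundle : ucb_bundle pq_base;
  pq_P : set (sec pq_bundle);
  pq_subalg : is_starsubalg pq_P;
  pq_dense : dense pq_P;
  pq_bracket : forall a b, pq_P a -> pq_P b ->
    exists2 c, pq_P c & scaled_commutator a b c;
  pq_comm : forall a b : sec pq_bundle,
    (fun h => `|commutator (phi pq_bundle h a) (phi pq_bundle h b)| : (R[i])^o)
      @ at0 pq_base --> (0 : (R[i])^o)
}.
Arguments pq_base {R} p.
Arguments pq_bundle {R} p.
Arguments pq_P {R} p.

Section classical_limit.
Variable R : realType.
Implicit Types A B : pqBundle R.

Definition pq_sec A : cstarAlg R := sec (pq_bundle A).
Definition pq_lim A : starAlg R := Lim (pq_bundle A).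
Definition pq_phi0 A : pq_sec A -> pq_lim A := phi0 (pq_bundle A).

(* Defined through arbitrary representatives; the value is 0 outside the image
   of [pq_P]. *)
Definition poisson A (x y : pq_lim A) : pq_lim A :=
  xget 0 [set z | exists a b c, [/\ pq_P A a, pq_P A b, pq_P A c,
    scaled_commutator a b c & [/\ pq_phi0 a = x, pq_phi0 b = y
                                & pq_phi0 c = z]]].

Definition lim_map A B (beta : pq_sec A -> pq_sec B) (x : pq_lim A) : pq_lim B :=
  xget 0 [set y | exists a, pq_phi0 a = x /\ pq_phi0 (beta a) = y].

End classical_limit.

Record category := Category {
  ob :> Type;
  hom : ob -> ob -> Type;
  idm : forall X, hom X X;
  comp : forall X Y Z, hom Y Z -> hom X Y -> hom X Z;
  comp_idl : forall X Y (f : hom X Y), comp (idm Y) f = f;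
  comp_idr : forall X Y (f : hom X Y), comp f (idm X) = f;
  compA : forall X Y Z W (f : hom Z W) (g : hom Y Z) (k : hom X Y),
    comp f (comp g k) = comp (comp f g) k
}.
Arguments hom {c}.
Arguments idm {c}.
Arguments comp {c X Y Z}.

Definition is_functor (C D : category) (F : C -> D)
    (Fm : forall X Y : C, hom X Y -> hom (F X) (F Y)) : Prop :=
  (forall X : C, Fm X X (idm X) = idm (F X)) /\
  (forall (X Y Z : C) (g : hom Y Z) (f : hom X Y),
     Fm X Z (comp g f) = comp (Fm Y Z g) (Fm X Y f)).

Section PQBun.
Variable R : realType.
Implicit Types A B : pqBundle R.

Definition metric_map (I J : metricType R) (alpha : I -> J) : Prop :=
  forall x y, mdist (alpha x) (alpha y) <= mdist x y.

Record is_bundle_hom (I J : metricType R) (A : ucb_bundle I) (B : ucb_bundle J)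
    (alpha : I -> J) (beta : sec A -> sec B) : Prop := IsBundleHom {
  bh_metric : metric_map alpha;
  bh_starhom : is_starhom beta;
  bh_compat : forall (a1 a2 : sec A) (h : I), phi A h a1 = phi A h a2 ->
    phi B (alpha h) (beta a1) = phi B (alpha h) (beta a2)
}.

Definition proper_map (I J : topologicalType) (alpha : I -> J) : Prop :=
  forall C : set J, compact C -> compact (alpha @^-1` C).

Definition smooth A B (beta : pq_sec A -> pq_sec B) : Prop :=
  forall a, pq_P A a -> pq_P B (beta a).

Definition second_order (I J : I1space R) (alpha : I -> J) : Prop :=
  exists2 K : R, 0 <= K &
    (fun h => `|(absI h)^-1 - (absI (alpha h))^-1|) @ at0 I --> K.

Record is_pq_morphism A B
    (s : (pq_base A -> pq_base B) * (pq_sec A -> pq_sec B)) : Prop :=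
  IsPQMorphism {
  pqm_hom : @is_bundle_hom _ _ (pq_bundle A) (pq_bundle B) s.1 s.2;
  pqm_proper : proper_map s.1;
  pqm_smooth : smooth s.2;
  pqm_second_order : second_order s.1
}.

Definition pq_hom A B := {s | @is_pq_morphism A B s}.

Lemma C1_dist_cvg (I : I1space R) (e : R) : 0 < e ->
  \forall h \near at0 I, absI h < e.
Proof.
move=> e0; have [[_ _ sym _ nb] _] := C1_distP I.
exists [set y | C1_dist (zeroI I) y < e]; first by rewrite nb; exists e.
by move=> h /=; rewrite /absI sym.
Qed.

Lemma absI_gt0 (I : I1space R) (h : I) : 0 < absI h.
Proof.
have [[ge0 d0 _ _ _] _] := C1_distP I.
rewrite lt_neqAle ge0 andbT; apply/negP => /eqP/esym/d0.
by [].
Qed.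

Lemma at0_filter (I : I1space R) : ProperFilter (at0 I).
Proof.
apply: filter_from_proper.
  apply: filter_from_filter; first by exists setT; exact: filterT.
  by move=> U V nU nV; exists (U `&` V); first exact: filterI.
move=> U [C [cC _] CU]; have [_ ncI _] := I1P I.
have /existsNP[h hC] : ~ forall h, C h.
  by move=> hC; apply: ncI; rewrite (_ : setT = C)//; apply/seteqP; split.
by exists h; apply: CU; left; exists h.
Qed.

Lemma proper_at0 (I J : I1space R) (alpha : I -> J) :
  proper_map alpha -> alpha @ at0 I --> at0 J.
Proof.
move=> pa V [U [C [cC clC] CU] UV].
have cpre := pa _ cC.
exists (Some @` (~` (alpha @^-1` C)) `|` [set None]).
  exists (alpha @^-1` C) => //; split => //.
  by apply: compact_closed cpre; exact: metric_hausdorff.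
by move=> h [[h' nC [<-]]|//]; apply/UV/CU; left; exists (alpha h').
Qed.

Lemma absI_le (I J : I1space R) (alpha : I -> J) (h : I) :
  metric_map alpha -> proper_map alpha -> absI (alpha h) <= absI h.
Proof.
move=> ma pa; apply/ler_addgt0Pr => e e0.
have e20 : 0 < e / 2 by rewrite divr_gt0.
have FI := at0_filter I.
have [h' [h'1 h'2]] := filter_ex (filterI (C1_dist_cvg I e20)
  (proper_at0 pa (C1_dist_cvg J e20))).
have [[_ _ symI triI _] isoI] := C1_distP I.
have [[_ _ symJ triJ _] isoJ] := C1_distP J.
have h1 : absI (alpha h) <= mdist (alpha h) (alpha h') + absI (alpha h').
  by rewrite /absI -isoJ; exact: triJ.
have h2 : mdist h h' <= absI h + absI h'.
  by rewrite /absI -isoI [C1_dist (Some h') _]symI; exact: triI.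
apply: (le_trans h1); rewrite [e]splitr addrA.
apply: lerD (ltW h'2).
apply: (le_trans (ma _ _)); apply: (le_trans h2).
by rewrite lerD2l ltW.
Qed.

Lemma second_order_comp (I J L : I1space R) (alpha : I -> J) (gamma : J -> L) :
  metric_map alpha -> proper_map alpha -> second_order alpha ->
  metric_map gamma -> proper_map gamma -> second_order gamma ->
  second_order (gamma \o alpha).
Proof.
move=> ma pa [K K0 aK] mg pg [K' K'0 gK].
exists (K' + K); first exact: addr_ge0.
have FI := at0_filter I; have FJ := at0_filter J.
have gaK := cvg_comp alpha _ (proper_at0 pa) gK.
rewrite (_ : (fun h => _) = fun h =>
  `|(absI (alpha h))^-1 - (absI (gamma (alpha h)))^-1| +
  `|(absI h)^-1 - (absI (alpha h))^-1|); first exact: cvgD gaK aK.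
apply/funext => h /=.
have le1 := absI_le h ma pa; have le2 := absI_le (alpha h) mg pg.
rewrite !ler0_norm ?subr_le0 ?lef_pV2 ?posrE ?absI_gt0//.
  by rewrite !opprB addrA subrK.
exact: le_trans le2 le1.
Qed.

Lemma id_pq_morphism A : @is_pq_morphism A A (id, id).
Proof.
have F0 := at0_filter (pq_base A).
split=> //; first by split.
exists 0 => //=.
rewrite (_ : (fun h => _) = fun=> 0); first exact: cvg_cst.
by apply/funext => h; rewrite subrr normr0.
Qed.

Definition pq_id A : pq_hom A A := exist _ _ (id_pq_morphism A).

Lemma comp_pq_morphism (A B C : pqBundle R) (t : pq_hom B C) (s : pq_hom A B) :
  is_pq_morphism ((sval t).1 \o (sval s).1, (sval t).2 \o (sval s).2).
Proof.
have [[tm tl tc] tp ts to] := svalP t; have [[sm sl sc] sp ss so] := svalP s.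
split=> /=.
- split=> [x y||] /=.
  + exact: le_trans (tm _ _) (sm _ _).
  + case: tl sl => [tl tM tS] [sl sM sS]; split=> [k a b|a b|a] /=.
    * by rewrite sl tl.
    * by rewrite sM tM.
    * by rewrite sS tS.
  + by move=> a1 a2 h E; apply: tc; apply: sc.
- by move=> D cD; exact: sp (tp _ cD).
- by move=> a Pa; exact/ts/ss.
- exact: second_order_comp.
Qed.

Definition pq_comp A B C (t : pq_hom B C) (s : pq_hom A B) : pq_hom A C :=
  exist _ _ (comp_pq_morphism t s).

Let pq_hom_eq A B (s t : pq_hom A B) : sval s = sval t -> s = t.
Proof.
by case: s t => [s sP] [t tP] /= st; subst t; rewrite (Prop_irrelevance sP tP).
Qed.

Let pq_idl A B (s : pq_hom A B) : pq_comp (pq_id B) s = s.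
Proof. by apply: pq_hom_eq; case: s => -[]. Qed.

Let pq_idr A B (s : pq_hom A B) : pq_comp s (pq_id A) = s.
Proof. by apply: pq_hom_eq; case: s => -[]. Qed.

Let pq_compA (A B C D : pqBundle R) (s : pq_hom C D) (t : pq_hom B C)
  (u : pq_hom A B) : pq_comp s (pq_comp t u) = pq_comp (pq_comp s t) u.
Proof. exact: pq_hom_eq. Qed.

Definition PQBun : category := Category pq_idl pq_idr pq_compA.

End PQBun.

Section Class.
Variable R : realType.

(* Only the values of the bracket on [cl_P] matter. *)
Record classData := ClassData {
  cl_alg : starAlg R;
  cl_P : set cl_alg;
  cl_br : cl_alg -> cl_alg -> cl_alg
}.

Record is_class_object (X : classData) : Prop := IsClassObject {
  co_cstar : is_cstar (cl_alg X);
  co_comm : forall x y : cl_alg X, x ** y = y ** x;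
  co_dense : dense (@cl_P X);
  co_P0 : @cl_P X 0;
  co_PD : forall x y, @cl_P X x -> cl_P y -> cl_P (x + y);
  co_PZ : forall (k : R[i]) x, @cl_P X x -> cl_P (k *: x);
  co_PM : forall x y, @cl_P X x -> cl_P y -> cl_P (x ** y);
  co_br : forall x y, @cl_P X x -> cl_P y -> cl_P (cl_br x y);
  co_br_linear : forall (k : R[i]) x y z,
    @cl_P X x -> cl_P y -> cl_P z ->
    cl_br (k *: x + y) z = k *: cl_br x z + cl_br y z;
  co_br_anti : forall x y, @cl_P X x -> cl_P y -> cl_br x y = - cl_br y x;
  co_jacobi : forall x y z, @cl_P X x -> cl_P y -> cl_P z ->
    cl_br x (cl_br y z) + cl_br y (cl_br z x) + cl_br z (cl_br x y) = 0;
  co_leibniz : forall x y z, @cl_P X x -> cl_P y -> cl_P z ->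
    cl_br x (y ** z) = cl_br x y ** z + y ** cl_br x z
}.

Record is_class_morphism (X Y : classData) (f : cl_alg X -> cl_alg Y) : Prop :=
  IsClassMorphism {
  cm_starhom : is_starhom f;
  cm_P : forall x, cl_P x -> cl_P (f x);
  cm_br : forall x y, cl_P x -> cl_P y -> cl_br (f x) (f y) = f (cl_br x y)
}.

Definition class_ob := {X | is_class_object X}.
Definition class_hom (X Y : class_ob) :=
  {f | @is_class_morphism (sval X) (sval Y) f}.

Lemma id_class_morphism X : @is_class_morphism X X id.
Proof. by []. Qed.

Lemma comp_class_morphism X Y Z g f :
  @is_class_morphism Y Z g -> @is_class_morphism X Y f ->
  is_class_morphism (g \o f).
Proof.
case=> [[gl gM gS] gP gb] [[fl fM fS] fP fb]; split=> [|x Px|x y Px Py] /=.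
- by split=> [k a b|a b|a] /=; rewrite ?fl ?gl ?fM ?gM ?fS ?gS.
- exact/gP/fP.
- by rewrite gb ?fb//; exact: fP.
Qed.

Definition class_id (X : class_ob) : class_hom X X :=
  exist _ _ (id_class_morphism (sval X)).

Definition class_comp (X Y Z : class_ob) (g : class_hom Y Z)
    (f : class_hom X Y) : class_hom X Z :=
  exist _ _ (comp_class_morphism (svalP g) (svalP f)).

Let class_hom_eq X Y (s t : class_hom X Y) : sval s = sval t -> s = t.
Proof.
by case: s t => [s sP] [t tP] /= st; subst t; rewrite (Prop_irrelevance sP tP).
Qed.

Let class_idl X Y (s : class_hom X Y) : class_comp (class_id Y) s = s.
Proof. exact: class_hom_eq. Qed.

Let class_idr X Y (s : class_hom X Y) : class_comp s (class_id X) = s.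
Proof. exact: class_hom_eq. Qed.

Let class_compA X Y Z W (s : class_hom Z W) (t : class_hom Y Z)
  (u : class_hom X Y) :
  class_comp s (class_comp t u) = class_comp (class_comp s t) u.
Proof. exact: class_hom_eq. Qed.

Definition Class : category := Category class_idl class_idr class_compA.

End Class.

Section LP.
Variable R : realType.

Definition LP_ob (A : pqBundle R) : classData R :=
  @ClassData R (pq_lim A) (@pq_phi0 R A @` pq_P A) (@poisson R A).

Definition LP_mor (A B : pqBundle R) (s : pq_hom A B) :
    cl_alg (LP_ob A) -> cl_alg (LP_ob B) := lim_map (sval s).2.

End LP.

(* Main.v *)
Require Import Defs.
From HB Require Import structures.
From mathcomp Require Import all_boot all_order all_algebra.
From mathcomp Require Import all_classical all_reals all_analysis.
From mathcomp Require Import complex ring lra.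
Set Implicit Arguments.
Unset Strict Implicit.
Unset Printing Implicit Defensive.
Import Order.TTheory GRing.Theory Num.Theory.
Import numFieldNormedType.Exports.
Local Open Scope classical_set_scope.
Local Open Scope complex_scope.
Local Open Scope ring_scope.

(** The limit algebra is the algebra of sections modulo those whose norms tend
    to 0 at the added point, and the bracket of a and b is the limit of
    (i/|h|) [a_h, b_h]. Four facts make this functorial.

    The bracket depends only on the classes of a and b. It must be shown that
    if a_h tends to 0 then so does c_h = (i/|h|) [a_h, b_h]. For self-adjoint b
    the map D = (i/|h|) [-, b_h] is, in each fibre, the generator of a group of
    isometries, so |y + sDy| >= |y| for every real s. This is obtained here
    without exponentials, from (1 - itb) y (1 + itb) and convexity
    ([rnorm_comm_ge]). Factoring 1 - s^2 D^2 then gives the Landau-Kolmogorov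
    type estimate s |Dy| <= 2 |y| + s^2 |D^2 y| ([rnorm_comm_interpolation]).
    For y = a_h the element D^2 y is the value at h of the iterated bracket,
    which is again a section and hence bounded in h, so Da_h tends to 0
    ([scaled_commutator_ideal]). A general b is reduced to its real and
    imaginary parts, which lie in the subalgebra.

    The limit algebra is a C*-algebra. Cutting off a section by the uniformly
    continuous function min(1, |h|/d) identifies the quotient norm with the
    upper limit of the fibre norms ([near_rnorm_phi_lt], [rnorm_phi0_le]), which
    inherits the C*-identity; completeness is that of any quotient by a closed
    subspace ([quot_complete]). The Poisson identities hold fibrewise for
    commutators.

    A morphism (alpha, beta) induces *-homomorphisms between fibres, and these
    are contractive ([starhom_contractive]): a self-adjoint h of norm less than
    1 is the imaginary part of a unitary 1 - k + ih of the unitization, where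
    k = (h^2 + k^2)/2 is found by iteration, and unitaries are mapped to
    unitaries. So beta maps sections vanishing at the added point to sections
    vanishing along alpha; as fibre norms are uniformly continuous and alpha is
    proper, these vanish at the added point of the target ([minext0_proper]).

    Finally, over alpha h the image of the bracket of a and b and the bracket of
    their images differ by i (1/|h| - 1/|alpha h|) times a commutator. The first
    factor stays bounded by the second-order condition and the commutator tends
    to 0, so the limits agree ([pq_phi0_bracket]). *)

(** * Real-valued norms *)

Section real_norm.
Variables (R : realType) (V : normedModType R[i]).
Implicit Types (v w : V) (r : R).

(** Norms here are elements of R[i]; taking real parts puts the estimates in a
    totally ordered field. *)
Definition rnorm v : R := complex.Re `|v|.

Lemma rnormE v : (rnorm v)%:C = `|v|.
Proof. by rewrite /rnorm RRe_real// normr_real. Qed.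

Lemma rnorm_ge0 v : 0 <= rnorm v.
Proof. by rewrite -lecR rnormE normr_ge0. Qed.

Lemma rnorm0 : rnorm (0 : V) = 0.
Proof. by apply: complexI; rewrite rnormE normr0. Qed.

Lemma rnormD v w : rnorm (v + w) <= rnorm v + rnorm w.
Proof. by rewrite -lecR rmorphD /= !rnormE ler_normD. Qed.

Lemma rnormN v : rnorm (- v) = rnorm v.
Proof. by apply: complexI; rewrite !rnormE normrN. Qed.

Lemma rnormB v w : rnorm (v - w) = rnorm (w - v).
Proof. by rewrite -opprB rnormN. Qed.

Lemma rnorm_subD v w : rnorm v <= rnorm (v + w) + rnorm w.
Proof. by rewrite -[in leLHS](addrK w v) -[in leRHS](rnormN w) rnormD. Qed.

Lemma rnormZ (k : R[i]) v : rnorm (k *: v) = complex.Re `|k| * rnorm v.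
Proof.
apply: complexI; rewrite rmorphM [LHS]rnormE normrZ.
by rewrite -{1}(RRe_real (normr_real k)) -rnormE.
Qed.

Lemma rnormZr r v : rnorm (r%:C *: v) = `|r| * rnorm v.
Proof. by rewrite rnormZ normc_def /= expr0n addr0 sqrtr_sqr. Qed.

Lemma rnormZi v : rnorm ('i *: v) = rnorm v.
Proof. by rewrite rnormZ normCi mul1r. Qed.

Lemma rnorm_eq0 v : rnorm v = 0 -> v = 0.
Proof. by move=> v0; apply/eqP; rewrite -normr_eq0 -rnormE v0. Qed.

End real_norm.

(** * Elementary C*-algebra estimates *)

Section starhom.
Variables (R : realType) (A B : starAlg R) (f : A -> B).
Hypothesis fP : is_starhom f.

Lemma starhomD x y : f (x + y) = f x + f y.
Proof. by have := sh_linear fP 1 x y; rewrite !scale1r. Qed.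

Lemma starhom0 : f 0 = 0.
Proof. by apply: (addrI (f 0)); rewrite -starhomD !addr0. Qed.

Lemma starhomZ (k : R[i]) x : f (k *: x) = k *: f x.
Proof. by have := sh_linear fP k x 0; rewrite starhom0 !addr0. Qed.

Lemma starhomN x : f (- x) = - f x.
Proof. by rewrite -scaleN1r starhomZ scaleN1r. Qed.

Lemma starhomB x y : f (x - y) = f x - f y.
Proof. by rewrite starhomD starhomN. Qed.

Lemma starhom_comm x y : f (commutator x y) = commutator (f x) (f y).
Proof. by rewrite /commutator starhomB !(sh_mul fP). Qed.

End starhom.

Lemma starhom_comp (R : realType) (A B C : starAlg R)
    (g : B -> C) (f : A -> B) :
  is_starhom g -> is_starhom f -> is_starhom (g \o f).
Proof.
move=> gP fP; split=> [k x y|x y|x] /=.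
- by rewrite (sh_linear fP) (sh_linear gP).
- by rewrite (sh_mul fP) (sh_mul gP).
- by rewrite (sh_star fP) (sh_star gP).
Qed.

Section cstar_algebra.
Variables (R : realType) (A : cstarAlg R).
Implicit Types (x y z v w : A) (k : R[i]) (t : R).

Lemma csA x y z : x ** (y ** z) = (x ** y) ** z.
Proof. exact: cs_mulA (cs_axioms A) _ _ _. Qed.
Lemma csDl x y z : (x + y) ** z = x ** z + y ** z.
Proof. exact: cs_mulDl (cs_axioms A) _ _ _. Qed.
Lemma csDr x y z : x ** (y + z) = x ** y + x ** z.
Proof. exact: cs_mulDr (cs_axioms A) _ _ _. Qed.
Lemma csZl k x y : (k *: x) ** y = k *: (x ** y).
Proof. exact: cs_scaleAl (cs_axioms A) _ _ _. Qed.
Lemma csZr k x y : x ** (k *: y) = k *: (x ** y).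
Proof. exact: cs_scaleAr (cs_axioms A) _ _ _. Qed.
Lemma csNl x y : (- x) ** y = - (x ** y).
Proof. by rewrite -(scaleN1r x) csZl scaleN1r. Qed.
Lemma csNr x y : x ** (- y) = - (x ** y).
Proof. by rewrite -(scaleN1r y) csZr scaleN1r. Qed.
Lemma csBl x y z : (x - y) ** z = x ** z - y ** z.
Proof. by rewrite csDl csNl. Qed.
Lemma csBr x y z : x ** (y - z) = x ** y - x ** z.
Proof. by rewrite csDr csNr. Qed.
Lemma cs0l x : 0 ** x = 0.
Proof. by rewrite -[0 in LHS](scale0r x) csZl scale0r. Qed.
Lemma cs0r x : x ** 0 = 0.
Proof. by rewrite -[0 in LHS](scale0r x) csZr scale0r. Qed.
Lemma starD x y : (x + y)^† = x^† + y^†.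
Proof. exact: cs_starD (cs_axioms A) _ _. Qed.
Lemma starZ k x : (k *: x)^† = k^* *: x^†.
Proof. exact: cs_starZ (cs_axioms A) _ _. Qed.
Lemma starK x : x^†^† = x.
Proof. exact: cs_starK (cs_axioms A) _. Qed.
Lemma starM x y : (x ** y)^† = y^† ** x^†.
Proof. exact: cs_starM (cs_axioms A) _ _. Qed.
Lemma starN x : (- x)^† = - x^†.
Proof. by rewrite -(scaleN1r x) starZ conj_Creal ?scaleN1r// rpredN real1. Qed.
Lemma starB x y : (x - y)^† = x^† - y^†.
Proof. by rewrite starD starN. Qed.
Lemma star0 : (0 : A)^† = 0.
Proof. by rewrite -[0 in LHS](subrr 0) starB subrr. Qed.
Lemma starZr t x : (t%:C *: x)^† = t%:C *: x^†.
Proof. by rewrite starZ conj_Creal// complex_real. Qed.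
Lemma starZi x : ('i *: x)^† = - ('i *: x^†).
Proof. by rewrite starZ conjCi scaleNr. Qed.

Lemma scaleii x : 'i *: ('i *: x) = - x.
Proof. by rewrite scalerA -expr2 sqrCi scaleN1r. Qed.

Lemma commutatorZr k x y : commutator x (k *: y) = k *: commutator x y.
Proof. by rewrite /commutator csZr csZl scalerBr. Qed.

Lemma commutatorZl k x y : commutator (k *: x) y = k *: commutator x y.
Proof. by rewrite /commutator csZr csZl scalerBr. Qed.

(** When v^† w is self-adjoint the cross terms cancel, as in the square of the
    modulus of a complex number. *)
Lemma star_mul_addi v w : v^† ** w = w^† ** v ->
  (v + 'i *: w)^† ** (v + 'i *: w) = v^† ** v + w^† ** w.
Proof.
move=> vw; rewrite starD starZi csDl !csDr !csNl !csZl !csZr vw.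
by rewrite scaleii opprK addrA addrK.
Qed.

Lemma rnormM x y : rnorm (x ** y) <= rnorm x * rnorm y.
Proof. by rewrite -lecR rmorphM /= !rnormE (cs_normM (cs_axioms A)). Qed.

Lemma rnorm_cstar x : rnorm (x^† ** x) = rnorm x ^+ 2.
Proof.
by apply: complexI; rewrite rmorphXn /= !rnormE (cs_norm_star (cs_axioms A)).
Qed.

Lemma rnorm_star x : rnorm x^† = rnorm x.
Proof.
suff le y : rnorm y <= rnorm y^†.
  by apply/eqP; rewrite eq_le le -[leRHS]/(rnorm x) -{2}(starK x) le.
have := rnormM y^† y; rewrite rnorm_cstar expr2.
have := rnorm_ge0 y; rewrite le_eqVlt => /predU1P[<- _|y0].
  exact: rnorm_ge0.
by rewrite ler_pM2r.
Qed.

End cstar_algebra.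

(** * Commutators with a self-adjoint element *)

Section dissipative.
Variables (R : realType) (A : cstarAlg R).
Implicit Types (x y z b : A) (s : R).

(** As b is self-adjoint, (z + i bz)^† (z + i bz) = z^† z + (bz)^† (bz) has no
    term of first order in b; hence 1 + ib can shrink norms only to second
    order. *)
Lemma rnorm_skewl_ge b z : b^† = b ->
  rnorm z ^+ 2 * (1 - rnorm b ^+ 2) <= rnorm (z + 'i *: (b ** z)) ^+ 2.
Proof.
move=> bsa; rewrite -[leRHS]rnorm_cstar.
rewrite star_mul_addi; last by rewrite starM bsa csA.
apply: le_trans (_ : _ <= rnorm z ^+ 2 - rnorm (b ** z) ^+ 2) _.
  rewrite mulrBr mulr1 lerB// -exprMn mulrC lerXn2r ?nnegrE ?rnorm_ge0 //.
    by rewrite mulr_ge0 ?rnorm_ge0.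
  exact: rnormM.
by rewrite -!rnorm_cstar lerBlDr; exact: rnorm_subD.
Qed.

Lemma rnorm_skewr_ge b z : b^† = b ->
  rnorm z ^+ 2 * (1 - rnorm b ^+ 2) <= rnorm (z + 'i *: (z ** b)) ^+ 2.
Proof.
move=> bsa; rewrite -(rnorm_star z) -(rnorm_star (_ + _)) -(rnormN b).
have -> : (z + 'i *: (z ** b))^† = z^† + 'i *: ((- b) ** z^†).
  by rewrite starD starZi starM bsa csNl scalerN.
by apply: rnorm_skewl_ge; rewrite starN bsa.
Qed.

(** To first order, y + i[y, b] is (1 - ib) y (1 + ib). *)
Lemma rnorm_comm_ge_quadratic b y : b^† = b ->
  rnorm y * (1 - 2 * rnorm b ^+ 2) <= rnorm (y + 'i *: commutator y b).
Proof.
move=> bsa; have y0 := rnorm_ge0 y; have b0 := rnorm_ge0 b.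
have [b1|b1] := leP (rnorm b) 1; last first.
  by apply: le_trans (rnorm_ge0 _); rewrite mulr_ge0_le0//; nra.
pose w := y + 'i *: ((- b) ** y).
have w1 : rnorm y ^+ 2 * (1 - rnorm b ^+ 2) <= rnorm w ^+ 2.
  by rewrite -(rnormN b); apply: rnorm_skewl_ge; rewrite starN bsa.
have w2 := rnorm_skewr_ge w bsa.
have wE : w + 'i *: (w ** b) = (y + 'i *: commutator y b) + b ** y ** b.
  rewrite /w /commutator csDl csZl !csNl scalerDr !scalerN scaleii opprK.
  by rewrite scalerBr !addrA; congr (_ + _); rewrite addrAC.
have w3 : rnorm y * (1 - rnorm b ^+ 2) <= rnorm (w + 'i *: (w ** b)).
  have B1 : 0 <= 1 - rnorm b ^+ 2 by rewrite subr_ge0 expr_le1.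
  rewrite -(@ler_pXn2r _ 2) ?nnegrE ?rnorm_ge0 ?mulr_ge0 //.
  apply: le_trans w2; rewrite exprMn [_ ^+ 2 in X in _ * X]expr2 mulrA.
  exact: ler_wpM2r.
have := rnormM (b ** y) b; have := rnormM b y; rewrite wE in w3.
have := rnormD (y + 'i *: commutator y b) (b ** y ** b); nra.
Qed.

(** Since s |-> |y + s i[y, b]| is convex, a bound that fails only
    quadratically near s = 0 improves to monotonicity: the derivation i[-, b]
    is dissipative. *)
Lemma rnorm_comm_ge b y : b^† = b ->
  rnorm y <= rnorm (y + 'i *: commutator y b).
Proof.
move=> bsa; apply/ler_addgt0Pr => e e0.
have y0 := rnorm_ge0 y; have b0 := rnorm_ge0 b.
(* The loss for s b is s^2 M; dividing it by s must leave at most e. *)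
pose M := 2 * rnorm b ^+ 2 * rnorm y.
have M0 : 0 <= M by rewrite !mulr_ge0// sqr_ge0.
pose s := e / (e + M).
have eM : 0 < e + M by lra.
have s0 : 0 < s by rewrite divr_gt0.
have s1 : s <= 1 by rewrite ler_pdivrMr//; lra.
have sM : s * M <= e by rewrite mulrAC ler_pdivrMr//; nra.
have := @rnorm_comm_ge_quadratic (s%:C *: b) y.
rewrite starZr bsa rnormZr (gtr0_norm s0) => /(_ erefl) q.
have E : y + 'i *: commutator y (s%:C *: b) =
    (1 - s)%:C *: y + s%:C *: (y + 'i *: commutator y b).
  rewrite commutatorZr (scalerDr _ y) addrA -scalerDl.
  by rewrite -rmorphD subrK scale1r !scalerA mulrC.
have := rnormD ((1 - s)%:C *: y) (s%:C *: (y + 'i *: commutator y b)).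
rewrite -E !rnormZr (gtr0_norm s0) ger0_norm ?subr_ge0// => q2.
rewrite -(ler_pM2l s0); rewrite /M in sM; nra.
Qed.

(** With D = i[-, b], the factorization (1 - D)(1 + D) = 1 - D^2 and
    dissipativity bound D y by y and D^2 y. Applied to the multiples of b this
    is an inequality of Landau-Kolmogorov type. *)
Lemma rnorm_comm_interpolation b y : b^† = b ->
  rnorm (commutator y b) <=
    2 * rnorm y + rnorm (commutator (commutator y b) b).
Proof.
move=> bsa; set d := commutator y b; set d2 := commutator d b.
have := @rnorm_comm_ge (- b) (y + 'i *: d).
rewrite starN bsa => /(_ erefl).
have -> : commutator (y + 'i *: d) (- b) = - (d + 'i *: d2).
  rewrite /d2 /commutator csNl csNr -opprD; congr (- _).
  by rewrite csDl csDr csZl csZr opprD addrACA -scalerBr.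
clearbody d2; clearbody d.
rewrite scalerN scalerDr scaleii opprD opprK addrA addrK => q.
have := rnormD y d2; have := rnormD (y + 'i *: d) (- y).
rewrite addrAC subrr add0r rnormZi rnormN; lra.
Qed.

End dissipative.

(** * Completeness *)

Lemma complex_gt0E (R : realType) (e : R[i]) : 0 < e ->
  exists2 r : R, 0 < r & e = r%:C.
Proof.
move=> e0; exists (complex.Re e); last by rewrite RRe_real ?gtr0_real.
by move: e0; rewrite ltcE => /andP[].
Qed.

Section complete.
Variables (R : realType) (V : normedModType R[i]).

Lemma ball_rnorm (x y : V) (e : R) :
  ball x e%:C y = (rnorm (x - y) < e) :> Prop.
Proof. by rewrite -ball_normE /= -rnormE ltcR. Qed.

Hypothesis V_complete :
  forall F : set_system V, ProperFilter F -> cauchy F -> cvg F.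

Lemma geometric_seq_cvg (u : nat -> V) (r C : R) : 0 <= r -> r < 1 ->
  (forall m n, rnorm (u (m + n)%N - u n) <= r ^+ n * C) ->
  exists l, forall e : R, 0 < e -> \forall n \near \oo, rnorm (u n - l) < e.
Proof.
move=> r0 r1 ur; have C0 : 0 <= C.
  by have := ur 0%N 0%N; rewrite subrr rnorm0 mul1r.
have uc : cauchy (u @ \oo).
  apply: cauchy_exP => _ /complex_gt0E[e e0 ->].
  have C1 : 0 < C + 1 by lra.
  have r1' : `|r| < 1 by rewrite ger0_norm.
  have /cvgrPdist_lt/(_ _ (divr_gt0 e0 C1))[N _ /(_ N (leqnn _)) /= rN] :=
    cvg_expr r1'.
  rewrite sub0r normrN ger0_norm ?exprn_ge0// ltr_pdivlMr// in rN.
  exists (u N), N => // n /= Nn; rewrite /= ball_rnorm rnormB.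
  have := ur (n - N)%N N; rewrite subnK// => /le_lt_trans; apply.
  apply: le_lt_trans rN; rewrite ler_wpM2l ?exprn_ge0//; lra.
have ul : cvg (u @ \oo) by exact: V_complete uc.
exists (lim (u @ \oo)) => e e0.
have e0' : 0 < e%:C by rewrite ltcR.
have : \forall n \near \oo, ball (lim (u @ \oo)) e%:C (u n).
  exact: ul _ (nbhsx_ballx _ _ e0').
by apply: filterS => n; rewrite ball_rnorm rnormB.
Qed.

End complete.

(** * Automatic contractivity of *-homomorphisms *)

Section contractive.
Variables (R : realType).


(** The equation on k says that (1 - k)^2 + h^2 = 1, so 1 - k + ih is a unitary
    of the unitization. *)
Lemma rnorm_rotation (A : cstarAlg R) (h k z : A) : h^† = h -> k^† = k ->
  h ** k = k ** h -> k + k = h ** h + k ** k ->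
  rnorm (z - k ** z + 'i *: (h ** z)) = rnorm z.
Proof.
move=> hsa ksa hk kE.
apply: (@pexpIrn _ 2); rewrite ?nnegrE ?rnorm_ge0 // -!rnorm_cstar.
congr rnorm; set v := z - k ** z; set w := h ** z.
have vw : v^† ** w = w^† ** v.
  rewrite /v /w starB !starM ksa hsa csBl csBr !csA; congr (_ - _).
  by rewrite -!csA (csA k) (csA h) hk.
rewrite star_mul_addi//.
have -> : w^† ** w =
    z^† ** (k ** z) + z^† ** (k ** z) - z^† ** (k ** (k ** z)).
  rewrite /w starM hsa -!csA (csA h h) -[h ** h](addrK (k ** k)) -kE.
  by rewrite csBl csDl csBr csDr -!csA.
rewrite /v starB starM ksa csBl !csBr -!csA.
set p := z^† ** z; set q := z^† ** (k ** z); set r := z^† ** _.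
have -> : q + q - r = - (- q + - (q - r)) by rewrite opprD !opprK addrA.
by rewrite -(addrA p) addrK.
Qed.

(** Here 1 - k + ih and 1 - k - ih both act isometrically, and h is their
    difference divided by 2i. *)
Lemma rnorm_mul_rotation (A : cstarAlg R) (h k z : A) : h^† = h -> k^† = k ->
  h ** k = k ** h -> k + k = h ** h + k ** k -> rnorm (h ** z) <= rnorm z.
Proof.
move=> hsa ksa hk kE; have hP := rnorm_rotation z hsa ksa hk kE.
have hN : rnorm (z - k ** z - 'i *: (h ** z)) = rnorm z.
  have := @rnorm_rotation A (- h) k z.
  by rewrite starN !csNl !csNr opprK hsa hk scalerN; apply.
have := rnormD (z - k ** z + 'i *: (h ** z)) (- (z - k ** z - 'i *: (h ** z))).
rewrite rnormN hN hP opprD opprK addrACA subrr add0r -scalerDr rnormZi.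
rewrite -[h ** z + _](_ : 2%:C *: (h ** z) = _); last first.
  by rewrite rmorphD scalerDl scale1r.
by rewrite rnormZr ger0_norm//; lra.
Qed.

(** The solution is the fixed point of the map k |-> (h^2 + k^2) / 2, which
    contracts the ball of radius |h| by the factor |h|. *)
Lemma rotation_exists (A : cstarAlg R) (h : A) : h^† = h -> rnorm h < 1 ->
  exists k : A, [/\ k^† = k, h ** k = k ** h & k + k = h ** h + k ** k].
Proof.
move=> hsa; set r := rnorm h => r1; have r0 : 0 <= r := rnorm_ge0 h.
pose T k : A := 2^-1%:C *: (h ** h + k ** k).
pose u n := iter n T 0.
have TB k l : rnorm (T k - T l) <= (rnorm k + rnorm l) / 2 * rnorm (k - l).
  rewrite /T -scalerBr opprD addrACA subrr add0r rnormZr ger0_norm ?invr_ge0//.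
  have -> : k ** k - l ** l = k ** (k - l) + (k - l) ** l.
    by rewrite csBr csBl addrA subrK.
  have := rnormD (k ** (k - l)) ((k - l) ** l).
  by have := rnormM k (k - l); have := rnormM (k - l) l; lra.
have ur n : rnorm (u n) <= r.
  elim: n => [|n IH]; first by rewrite rnorm0.
  rewrite /= rnormZr ger0_norm ?invr_ge0//.
  have := rnormD (h ** h) (u n ** u n); have := rnormM h h.
  have := rnormM (u n) (u n); have := rnorm_ge0 (u n); rewrite -/r -/(u n); nra.
have usa n : (u n)^† = u n.
  elim: n => [|n IH]; first exact: star0.
  by rewrite /= starZr starD !starM hsa -/(u n) IH.
have uh n : h ** u n = u n ** h.
  elim: n => [|n IH]; first by rewrite cs0l cs0r.
  by rewrite /= csZr csZl csDr csDl -/(u n) !csA IH -!csA IH.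
have uu m n : rnorm (u (m + n)%N - u n) <= r ^+ n * r.
  elim: n => [|n IH]; first by rewrite addn0 subr0 mul1r.
  rewrite addnS /= -!/(u _); apply: le_trans (TB _ _) _.
  rewrite exprS -(mulrA r); apply: ler_pM => //; rewrite ?rnorm_ge0//.
    by rewrite divr_ge0 ?addr_ge0 ?rnorm_ge0.
  by have := ur (m + n)%N; have := ur n; lra.
have [k uk] := geometric_seq_cvg (cs_complete (cs_axioms A)) r0 r1 uu.
have vanish (x : A) M :
    (forall n, rnorm x <= M * (rnorm (u n - k) + rnorm (u n.+1 - k))) -> x = 0.
  move=> xu; apply: rnorm_eq0; apply/eqP; rewrite eq_le rnorm_ge0 andbT.
  apply/ler_addgt0Pr => e e0; rewrite add0r.
  have M0 : 0 < 2 * (`|M| + 1) by rewrite mulr_gt0// ltr_wpDl.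
  have [N _ uN] := uk (e / (2 * (`|M| + 1))) (divr_gt0 e0 M0).
  have /= := uN N (leqnn _); have /= := uN N.+1 (leqnSn _).
  rewrite !ltr_pdivlMr// => u1 u2; apply: le_trans (xu N) _.
  have := rnorm_ge0 (u N - k); have := rnorm_ge0 (u N.+1 - k).
  have := ler_norm M; rewrite /= in u1 *; nra.
exists k; split.
- apply/eqP; rewrite -subr_eq0; apply/eqP/(@vanish _ 2) => n.
  have := rnorm_ge0 (u n.+1 - k); have := rnormD (k^† - u n) (u n - k).
  rewrite addrA subrK.
  by rewrite -[in k^† - _](usa n) -starB rnorm_star (rnormB k); lra.
- apply/eqP; rewrite -subr_eq0; apply/eqP/(@vanish _ (2 * r)) => n.
  have -> : h ** k - k ** h = (u n - k) ** h - h ** (u n - k).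
    by rewrite csBl csBr uh opprB [RHS]addrC addrA subrK.
  have := rnormD ((u n - k) ** h) (- (h ** (u n - k))); rewrite rnormN.
  have := rnormM (u n - k) h; have := rnormM h (u n - k); rewrite -/r.
  by have := mulr_ge0 r0 (rnorm_ge0 (u n.+1 - k)); lra.
suff kT : k = T k.
  rewrite -[h ** h + _](_ : 2%:C *: T k = _); last first.
    by rewrite /T scalerA -rmorphM divff// scale1r.
  by rewrite -kT rmorphD scalerDl scale1r.
apply/eqP; rewrite -subr_eq0.
apply/eqP/(@vanish _ (rnorm k + r + 1)) => n.
have := TB (u n) k; have := rnormD (k - u n.+1) (u n.+1 - T k).
rewrite addrA subrK (rnormB k (u n.+1)) -[u n.+1 - T k]/(T (u n) - T k).
have := rnorm_ge0 (u n - k); have := rnorm_ge0 (u n.+1 - k).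
by have := rnorm_ge0 k; have := rnorm_ge0 (u n); have := ur n; nra.
Qed.

Section starhom.
Variables (A B : cstarAlg R) (f : A -> B).
Hypothesis fP : is_starhom f.

(** A *-homomorphism transports the equation on k, so the image of h is again a
    contraction as a left multiplier; applying it to itself bounds its norm. *)
Lemma starhom_sa_lt1 h : h^† = h -> rnorm h < 1 -> rnorm (f h) <= 1.
Proof.
move=> hsa h1; have [k [ksa hk kE]] := rotation_exists hsa h1.
have fsa x : x^† = x -> (f x)^† = f x.
  by move=> xsa; rewrite -(sh_star fP) xsa.
have := @rnorm_mul_rotation B (f h) (f k) (f h) (fsa _ hsa) (fsa _ ksa).
rewrite -!(sh_mul fP) -!(starhomD fP) hk kE => /(_ erefl erefl).
rewrite -{1}hsa (sh_mul fP) (sh_star fP) rnorm_cstar expr2.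
have := rnorm_ge0 (f h); rewrite le_eqVlt => /predU1P[<- _|f0].
  exact: ler01.
by rewrite ger_pMr.
Qed.

Lemma starhom_contractive x : rnorm (f x) <= rnorm x.
Proof.
have sa y : y^† = y -> rnorm (f y) <= rnorm y.
  move=> ysa; apply/ler_addgt0Pr => e e0.
  have s0 : 0 < rnorm y + e by rewrite ltr_wpDl ?rnorm_ge0.
  have := @starhom_sa_lt1 ((rnorm y + e)^-1%:C *: y).
  rewrite starZr ysa (starhomZ fP) !rnormZr gtr0_norm ?invr_gt0//.
  by rewrite !ler_pdivrMl ?ltr_pdivrMl// !mulr1 ltrDl => /(_ erefl e0).
rewrite -(@ler_pXn2r _ 2) ?nnegrE ?rnorm_ge0// -!rnorm_cstar.
by rewrite -(sh_star fP) -(sh_mul fP) sa// starM starK.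
Qed.

End starhom.

(** A *-homomorphism that factors, as a map, through a surjective one is
    dominated by it, since the factor is again a *-homomorphism. *)
Lemma starhom_factor_le (A B C : cstarAlg R) (p : A -> B) (g : A -> C) :
  is_starhom p -> is_starhom g -> (forall y, exists x, p x = y) ->
  (forall x y, p x = p y -> g x = g y) -> forall x, rnorm (g x) <= rnorm (p x).
Proof.
move=> pP gP psurj pg; pose f y := g (sval (cid (psurj y))).
have fE x : f (p x) = g x by apply: pg; exact: svalP (cid (psurj (p x))).
have fP : is_starhom f.
  split=> [k y z|y z|y].
  - have [a <-] := psurj y; have [b <-] := psurj z.
    by rewrite -(sh_linear pP) !fE (sh_linear gP).
  - have [a <-] := psurj y; have [b <-] := psurj z.
    by rewrite -(sh_mul pP) !fE (sh_mul gP).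
  - by have [a <-] := psurj y; rewrite -(sh_star pP) !fE (sh_star gP).
by move=> x; rewrite -fE starhom_contractive.
Qed.

End contractive.

(** * Germs at the added point *)

Section base.
Variables (R : realType) (I : I1space R).
Implicit Types (h : I) (d e : R).

Lemma at0P (P : set I) :
  (\forall h \near at0 I, P h) <->
  exists2 d, 0 < d & forall h, absI h < d -> P h.
Proof.
have [[_ _ sym _ nb] _] := C1_distP I; split.
  case=> U; rewrite nb => -[d /= d0 dU] UP; exists d => // h hd.
  by apply/UP/dU => /=; rewrite sym.
have FI := at0_filter I; move=> [d d0 dP].
exact: filterS dP (C1_dist_cvg I d0).
Qed.

Lemma absI_dist h h' : absI h <= mdist h h' + absI h'.
Proof.
by have [[_ _ _ tri _] iso] := C1_distP I; rewrite /absI -iso; exact: tri.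
Qed.

Lemma dist_absI h h' : mdist h h' <= absI h + absI h'.
Proof.
have [[_ _ sym tri _] iso] := C1_distP I.
by rewrite /absI -iso (sym (Some h')); exact: tri.
Qed.

Lemma at0_near_lt e : 0 < e -> exists h, absI h < e.
Proof.
by move=> e0; have FI := at0_filter I; exact: filter_ex (C1_dist_cvg I e0).
Qed.

End base.

Lemma normc_real (R : realType) (x : R) : `|x%:C| = `|x|%:C.
Proof. by rewrite normc_def /= expr0n addr0 sqrtr_sqr. Qed.

Lemma unif_continuous_realP (R : realType) (I : metricType R) (f : I -> R) :
  unif_continuous (fun x => (f x)%:C : (R[i])^o) <->
  forall e, 0 < e -> exists2 d, 0 < d &
    forall x y, mdist x y < d -> `|f x - f y| < e.
Proof.
have ballE (x y : R) e :
    ball (x%:C : (R[i])^o) e%:C y%:C = (`|x - y| < e) :> Prop.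
  by rewrite /ball /= /ball_ /= -rmorphB normc_real ltcR.
split=> [uc e e0|uc U].
  have : entourage [set p : I * I |
      ball ((f p.1)%:C : (R[i])^o) e%:C (f p.2)%:C].
    apply: (uc [set p | ball (p.1 : (R[i])^o) e%:C p.2]).
    by rewrite -entourage_ballE; exists e%:C => //=; rewrite ltcR.
  rewrite -entourage_ballE => -[d /= d0 du]; exists d => // x y xy.
  by rewrite -ballE; apply: (du (x, y)); rewrite /= ballEmdist.
rewrite -entourage_ballE => -[_ /complex_gt0E[e e0 ->] eU].
have [d d0 du] := uc e e0.
rewrite /nbhs /= -entourage_ballE; exists d => //= -[x y] /=.
by rewrite ballEmdist => /du xy; apply: eU => /=; rewrite ballE.
Qed.

Section germs.
Variables (R : realType) (I : I1space R) (A : ucb_bundle I).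
Implicit Types (a b : sec A) (h : I) (e r : R).

Lemma rnorm_phi_le a h : rnorm (phi A h a) <= rnorm a.
Proof. by rewrite -lecR !rnormE; have [+ _] := phi_norm a; apply; exists h. Qed.

Lemma rnorm_sec_le a r : (forall h, rnorm (phi A h a) <= r) -> rnorm a <= r.
Proof.
move=> ar; rewrite -lecR !rnormE; have [_] := phi_norm a; apply=> _ [h _ <-].
by rewrite -rnormE lecR.
Qed.

(** The norm functions have a limit at the added point: points close to it
    are close to each other. *)
Lemma rnorm_phi_cauchy a e : 0 < e -> exists2 d : R, 0 < d &
  forall h h', absI h < d -> absI h' < d ->
    rnorm (phi A h a) < rnorm (phi A h' a) + e.
Proof.
move=> e0; have [uc _] := ucb_norm a.
have {}uc : unif_continuous (fun h : I => (rnorm (phi A h a))%:C : (R[i])^o).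
  by rewrite (_ : (fun h => _) = fun h => `|phi A h a|)//; apply/funext => h;
     exact: rnormE.
have [d d0 ad] := (unif_continuous_realP _).1 uc e e0.
exists (d / 2); first by rewrite divr_gt0.
move=> h h' hd h'd; rewrite addrC -ltrBlDr; apply: le_lt_trans (ler_norm _) _.
by apply/ad/(le_lt_trans (dist_absI _ _)); lra.
Qed.

(** Nets in the definition of the ideal may be replaced by the filter of
    neighbourhoods of the added point: the base space itself, ordered by
    decreasing distance to that point, is a net converging to it. *)
Lemma minext0P a : minext_set (zeroI I) a <->
  forall e, 0 < e -> \forall h \near at0 I, rnorm (phi A h a) < e.
Proof.
have [[_ _ sym _ nb] _] := C1_distP I.
split=> [aK e e0|a0 D le Dle i i0].
  pose le h h' : Prop := absI h' <= absI h.
  have Dle : directed_set le.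
    split=> [|h|h1 h2 h3 h12 h23|h h'].
    - by have [h _] := @at0_near_lt _ I 1 ltr01; exists.
    - exact: lexx.
    - exact: le_trans h23 h12.
    - have [hh|/ltW hh] := leP (absI h) (absI h').
        by exists h; split => //; exact: lexx.
      by exists h'; split => //; exact: lexx.
  have FF := tails_filter Dle.
  have i0 : (fun h => Some h : one_point_compactification I) @ tails le
      --> zeroI I.
    move=> U /=; rewrite nb => -[d /= d0 dU].
    have [h0 h0d] := @at0_near_lt _ I d d0; exists h0 => // h /= h0h.
    by apply: dU => /=; rewrite sym; exact: le_lt_trans h0h h0d.
  have e0' : 0 < e%:C by rewrite ltcR.
  have /cvgrPdist_lt/(_ _ e0')[h0 _ h0e] := aK _ _ Dle id i0.
  apply/at0P; exists (absI h0); first exact: absI_gt0.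
  move=> h /ltW /h0e /=.
  by rewrite sub0r normrN normr_id -rnormE ltcR.
have FF := tails_filter Dle.
apply/cvgrPdist_lt => _ /complex_gt0E[e e0 ->].
have [d d0 ad] := (at0P _).1 (a0 e e0).
have U0 : nbhs (zeroI I) [set y | C1_dist (zeroI I) y < d].
  by rewrite nb; exists d.
have : \forall x \near tails le, C1_dist (zeroI I) (Some (i x)) < d.
  exact: i0 _ U0.
apply: filterS => x; rewrite sym => /ad.
by rewrite sub0r normrN normr_id -rnormE ltcR.
Qed.

Lemma phi0_eq a b : phi0 A a = phi0 A b <->
  forall e, 0 < e -> \forall h \near at0 I, rnorm (phi A h (a - b)) < e.
Proof. by rewrite -minext0P; exact: qpi_eq. Qed.

End germs.

(** * Quotient C*-algebras *)

Section quotient.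
Variables (R : realType) (A : cstarAlg R) (K : closed_ideal A).
Implicit Types (a b : A) (x y : quotAlg K) (r : R).

Local Notation pi := (@qpi R A K : A -> quotAlg K).

Lemma closed_idealN a : K a -> K (- a).
Proof. by move=> Ka; rewrite -scaleN1r; exact: ciZ. Qed.

Lemma qrepr_subl a : K (a - qrepr (pi a)).
Proof. by rewrite -opprB; apply: closed_idealN; exact: qreprP. Qed.

Lemma qpi_surj x : exists a, pi a = x.
Proof. by exists (qrepr x); exact: qreprK. Qed.

Lemma qpi_linear : linear pi.
Proof.
move=> k a b; apply/qpi_eq.
set c := qrepr _; set d := qrepr _; have Kc : K (k *: a - c).
  rewrite -(subrK (k *: qrepr (pi a)) (k *: a)) -addrA -scalerBr.
  by apply: ciD (qrepr_subl _); apply: ciZ; exact: qrepr_subl.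
by rewrite opprD addrACA; apply: ciD Kc _; exact: qrepr_subl.
Qed.

Lemma qpiM a b : pi (a ** b) = pi a ** pi b.
Proof.
apply/qpi_eq; set c := qrepr _; set d := qrepr _.
have -> : a ** b - c ** d = a ** (b - d) + (a - c) ** d.
  by rewrite csBr csBl addrA subrK.
by apply: ciD; [apply: ciMl|apply: ciMr]; exact: qrepr_subl.
Qed.

Lemma rnorm_quotE x : rnorm x = inf (qnorm_set x).
Proof. by []. Qed.

Lemma rnorm_qpi_le a : rnorm (pi a) <= rnorm a.
Proof.
rewrite (rnorm_quotE (pi a)); apply: ge_inf; last by exists a.
by exists 0 => _ [b _ <-]; exact: rnorm_ge0.
Qed.

Lemma rnorm_quot_lift x r : rnorm x < r -> exists2 a, pi a = x & rnorm a < r.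
Proof.
rewrite (rnorm_quotE x) => xr.
have [|_ [a ax <-] ar] := inf_lt _ xr; last by exists a.
by have [a ax] := qpi_surj x; exists (rnorm a), a.
Qed.

(** A Cauchy filter is squeezed along a geometric sequence, whose increments
    are lifted one by one with control of the norm. *)
Lemma quot_complete (F : set_system (quotAlg K)) :
  ProperFilter F -> cauchy F -> cvg F.
Proof.
move=> FF /cauchyP Fc; pose s n : R := 2^-1 ^+ n.
have s0 n : 0 < s n by rewrite exprn_gt0// invr_gt0.
have sS n : s n.+1 = s n / 2 by rewrite /s exprSr.
have /choice[x Fx] : forall n, exists x, F (ball x (s n)%:C).
  by move=> n; apply: Fc; rewrite ltcR.
have /choice[d dP] : forall n, exists d, pi d = x n.+1 - x n /\
    rnorm d < 2 * s n.
  move=> n; have [y []] := filter_ex (filterI (Fx n) (Fx n.+1)).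
  rewrite !ball_rnorm (rnormB (x n)) => yn yn1.
  have [|d dx dn] := @rnorm_quot_lift (x n.+1 - x n) (2 * s n).
    have := rnormD (x n.+1 - y) (y - x n); rewrite addrA subrK.
    by have := s0 n; rewrite sS in yn1; lra.
  by exists d.
pose u n := qrepr (x 0%N) + \sum_(k < n) d k.
have uS n : u n.+1 = u n + d n by rewrite /u big_ord_recr addrA.
have ux n : pi (u n) = x n.
  elim: n => [|n IH]; first by rewrite /u big_ord0 addr0; exact: qreprK.
  have := qpi_linear 1 (u n) (d n); rewrite !scale1r uS => ->.
  by rewrite IH (dP n).1 addrC subrK.
have uu m n : rnorm (u (m + n)%N - u n) <= 4 * s n - 4 * s (m + n)%N.
  elim: m => [|m IH]; first by rewrite subrr rnorm0 subrr.
  rewrite addSn uS addrAC; apply: le_trans (rnormD _ _) _.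
  by have := (dP (m + n)%N).2; rewrite sS; lra.
have [l ul] : exists l, forall e : R, 0 < e ->
    \forall n \near \oo, rnorm (u n - l) < e.
  apply: (@geometric_seq_cvg _ _ (cs_complete (cs_axioms A)) u 2^-1 4) => //.
    by lra.
  by move=> m n; have := uu m n; have := s0 (m + n)%N; rewrite -/(s n); lra.
apply/cvg_ex; exists (pi l) => U /nbhs_ballP[_ /complex_gt0E[e e0 ->] eU].
have e20 : 0 < e / 2 by rewrite divr_gt0.
have s1 : `|2^-1 : R| < 1 by rewrite ger0_norm//; lra.
have /cvgrPdist_lt/(_ _ e20)[N1 _ sN] := cvg_expr s1.
have [N2 _ uN] := ul _ e20; pose n := maxn N1 N2.
have /= := sN n (leq_maxl _ _); have /= := uN n (leq_maxr _ _).
rewrite sub0r normrN -/(s n) (gtr0_norm (s0 n)) => un sn.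
apply: filterS (Fx n) => y; rewrite ball_rnorm => xy; apply: eU.
rewrite ball_rnorm.
have := rnormD (pi l - x n) (x n - y); rewrite addrA subrK.
have := rnorm_qpi_le (l - u n).
have -> : pi (l - u n) = pi l - x n.
  have := qpi_linear (-1) (u n) l; rewrite !scaleN1r ux => E.
  by rewrite addrC E addrC.
by rewrite (rnormB l); lra.
Qed.

End quotient.

(** * The fibre at the added point *)

Section limit_fibre.
Variables (R : realType) (I : I1space R) (A : ucb_bundle I).
Implicit Types (a b : sec A) (x y : Lim A) (h : I) (e r : R).

Lemma phi0_surj x : exists a, phi0 A a = x.
Proof. exact: qpi_surj. Qed.

Lemma phi0_starhom : is_starhom (phi0 A).
Proof.
split=> [k a b|a b|a]; [exact: qpi_linear|exact: qpiM|].
apply/qpi_eq; set c := qrepr _; rewrite -[_ - _]/(a^† - c^†) -starB.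
have /minext0P ac : minext_set (zeroI I) (a - c) by
  exact: (@qrepr_subl _ _ (@minext_ideal R I A (zeroI I))).
apply/minext0P => e /ac; apply: (@filterS _ _ (at0_filter I)) => h.
by rewrite (sh_star (phi_starhom A h)) rnorm_star.
Qed.

Lemma near_rnorm_phi_lt a r : rnorm (phi0 A a) < r ->
  \forall h \near at0 I, rnorm (phi A h a) < r.
Proof.
move=> /rnorm_quot_lift[b /esym/phi0_eq ab br].
have FI := at0_filter I; have rb : 0 < r - rnorm b by rewrite subr_gt0.
apply: filterS (ab _ rb) => h abh; have := rnorm_phi_le b h.
have := rnormD (phi A h (a - b)) (phi A h b).
by rewrite -(starhomD (phi_starhom A h)) subrK; lra.
Qed.

(** Multiplying by the cut-off function min(1, |h| / d) changes nothing far
    from the added point and gives an element of the ideal; subtracting the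
    product therefore yields a representative that is small everywhere. *)
Lemma rnorm_phi0_le a r : 0 <= r ->
  (\forall h \near at0 I, rnorm (phi A h a) <= r) -> rnorm (phi0 A a) <= r.
Proof.
move=> r0 /at0P[d d0 ad]; pose f h : R := Num.min 1 (absI h / d).
have f0 h : 0 <= f h.
  by rewrite le_min ler01 divr_ge0// ltW// absI_gt0.
have f1 h : f h <= 1 by rewrite ge_min lexx.
have fd h : f h <= absI h / d by rewrite ge_min lexx orbT.
have fucb : UCb (fun h => (f h)%:C).
  split; last by exists 1 => h; rewrite normc_real lecR ger0_norm.
  apply/unif_continuous_realP => e e0; exists (e * d); first exact: mulr_gt0.
  move=> h h' hh'.
  have lip u v : mdist u v < e * d -> f u - f v < e.
    move=> uv; have uvI := absI_dist u v; rewrite /f.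
    have : absI u / d - absI v / d < e by rewrite -mulrBl ltr_pdivrMr//; lra.
    by move=> UV; case: (leP 1 (absI u / d)); case: (leP 1 (absI v / d)); lra.
  by rewrite ltr_norml ltrNl opprB !lip// metric_sym.
have [fa faE] := ucb_act a fucb.
have fhom h := phi_starhom A h.
have <- : phi0 A (a - fa) = phi0 A a.
  apply/phi0_eq => e e0; rewrite addrAC subrr add0r.
  have a1 : 0 < rnorm a + 1 by rewrite ltr_wpDl ?rnorm_ge0.
  have c0 : 0 < e * d / (rnorm a + 1) by rewrite divr_gt0 ?mulr_gt0.
  apply/at0P; exists (e * d / (rnorm a + 1)) => // h hd.
  rewrite (starhomN (fhom h)) rnormN faE rnormZr ger0_norm//.
  apply: (@le_lt_trans _ _ (absI h / d * (rnorm a + 1))).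
    apply: ler_pM => //; first exact: rnorm_ge0.
    by have := rnorm_phi_le a h; lra.
  rewrite ltr_pdivlMr// in hd.
  by rewrite mulrAC ltr_pdivrMr.
apply: le_trans (rnorm_qpi_le _ _) _; apply: rnorm_sec_le => h.
rewrite (starhomB (fhom h)) faE -{1}(scale1r (phi A h a)) -scalerBl.
rewrite -[1]/(1%:C) -rmorphB rnormZr ger0_norm ?subr_ge0//.
have [hd|hd] := ltP (absI h) d.
  apply: le_trans (ad _ hd); rewrite ler_piMl ?rnorm_ge0//.
  by have := f0 h; lra.
have -> : f h = 1 by rewrite /f min_l// ler_pdivlMr// mul1r.
by rewrite subrr mul0r.
Qed.

(** The norm at the added point is the upper limit of the norms in the fibres,
    so it inherits submultiplicativity and the C*-identity from them. *)
Lemma Lim_cstar : is_cstar (Lim A).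
Proof.
have FI := at0_filter I.
have [lin mul star] := phi0_starhom.
have D a b := starhomD phi0_starhom a b.
have Z k a := starhomZ phi0_starhom k a.
have le_mul x y : rnorm (x ** y) <= rnorm x * rnorm y.
  have [a ax] := phi0_surj x; have [b yb] := phi0_surj y.
  have le r s : rnorm x < r -> rnorm y < s -> rnorm (x ** y) <= r * s.
    rewrite -ax -yb => /[dup] ar /near_rnorm_phi_lt na /[dup] bs.
    move=> /near_rnorm_phi_lt nb; rewrite -mul.
    have r0 : 0 <= r by rewrite (le_trans _ (ltW ar)) ?rnorm_ge0.
    have s0 : 0 <= s by rewrite (le_trans _ (ltW bs)) ?rnorm_ge0.
    apply: rnorm_phi0_le; first exact: mulr_ge0.
    apply: filterS2 na nb => h ha hb; rewrite (sh_mul (phi_starhom A h)).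
    by apply: le_trans (rnormM _ _) _; rewrite ler_pM ?rnorm_ge0// ltW.
  apply/ler_addgt0Pr => e e0.
  have x0 := rnorm_ge0 x; have y0 := rnorm_ge0 y.
  have S0 : 0 < rnorm x + rnorm y + 1 by lra.
  pose t := Num.min 1 (e / (rnorm x + rnorm y + 1)).
  have t0 : 0 < t by rewrite lt_min ltr01 divr_gt0.
  have t1 : t <= 1 by rewrite ge_min lexx.
  have te : t * (rnorm x + rnorm y + 1) <= e.
    by rewrite -ler_pdivlMr// ge_min lexx orbT.
  have := le (rnorm x + t) (rnorm y + t); rewrite !ltrDl => /(_ t0 t0); nra.
have star_le x : rnorm x^† <= rnorm x.
  have [a <-] := phi0_surj x; rewrite -star; apply/ler_addgt0Pr => e e0.
  apply: rnorm_phi0_le; first by rewrite addr_ge0 ?rnorm_ge0// ltW.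
  have : rnorm (phi0 A a) < rnorm (phi0 A a) + e by rewrite ltrDl.
  move=> /near_rnorm_phi_lt; apply: filterS => h /ltW.
  by rewrite (sh_star (phi_starhom A h)) rnorm_star.
split.
- exact: quot_complete.
- move=> x y z; have [a <-] := phi0_surj x; have [b <-] := phi0_surj y.
  by have [c <-] := phi0_surj z; rewrite -!mul csA.
- move=> x y z; have [a <-] := phi0_surj x; have [b <-] := phi0_surj y.
  by have [c <-] := phi0_surj z; rewrite -D -!mul -D csDl.
- move=> x y z; have [a <-] := phi0_surj x; have [b <-] := phi0_surj y.
  by have [c <-] := phi0_surj z; rewrite -D -!mul -D csDr.
- move=> k x y; have [a <-] := phi0_surj x; have [b <-] := phi0_surj y.
  by rewrite -(mul a b) -!Z -mul csZl.
- move=> k x y; have [a <-] := phi0_surj x; have [b <-] := phi0_surj y.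
  by rewrite -(mul a b) -!Z -mul csZr.
- move=> x y; have [a <-] := phi0_surj x; have [b <-] := phi0_surj y.
  by rewrite -(star a) -(star b) -!D -star starD.
- move=> k x; have [a <-] := phi0_surj x.
  by rewrite -(star a) -!Z -star starZ.
- by move=> x; have [a <-] := phi0_surj x; rewrite -!star starK.
- move=> x y; have [a <-] := phi0_surj x; have [b <-] := phi0_surj y.
  by rewrite -(mul a b) -(star a) -(star b) -(mul b^† a^†) -star starM.
- by move=> x y; rewrite -!rnormE -rmorphM lecR.
- move=> x; rewrite -!rnormE -rmorphXn; congr (_%:C).
  apply/eqP; rewrite eq_le; apply/andP; split.
    by apply: le_trans (le_mul _ _) _; rewrite expr2 ler_wpM2r ?rnorm_ge0.
  have [a <-] := phi0_surj x; rewrite -star -mul; apply/ler_addgt0Pr => e e0.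
  set r := _ + e; have r0 : 0 <= r by rewrite addr_ge0 ?rnorm_ge0// ltW.
  have : rnorm (phi0 A (a^† ** a)) < r by rewrite ltrDl.
  move=> /near_rnorm_phi_lt nr; rewrite -(sqr_sqrtr r0).
  rewrite lerXn2r ?nnegrE ?rnorm_ge0//.
  apply: rnorm_phi0_le; first exact: sqrtr_ge0.
  apply: filterS nr => h /ltW.
  have hP := phi_starhom A h; rewrite (sh_mul hP) (sh_star hP) rnorm_cstar.
  move=> /ler_wsqrtr; rewrite sqrtr_sqr ger0_norm//; exact: rnorm_ge0.
Qed.

End limit_fibre.

(** * Scaled commutators *)

Section scaled_commutator.
Variables (R : realType) (I : I1space R) (A : ucb_bundle I).
Implicit Types (a b c x y z : sec A) (h : I).

Lemma sec_eq a b : (forall h, phi A h a = phi A h b) -> a = b.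
Proof.
move=> ab; apply/eqP; rewrite -subr_eq0; apply/eqP/rnorm_eq0/eqP.
rewrite eq_le rnorm_ge0 andbT; apply: rnorm_sec_le => h.
by rewrite (starhomB (phi_starhom A h)) ab subrr rnorm0.
Qed.

Lemma scaled_commutatorP a b c : scaled_commutator a b c <->
  forall h, phi A h c =
    ((absI h)^-1)%:C *: ('i *: commutator (phi A h a) (phi A h b)).
Proof.
by split=> abc h; rewrite abc scalerA mulrC fmorphV.
Qed.

Lemma scaled_commutator_inj a b c c' :
  scaled_commutator a b c -> scaled_commutator a b c' -> c = c'.
Proof. by move=> abc abc'; apply: sec_eq => h; rewrite abc abc'. Qed.

Lemma scaled_commutator_sym a b c :
  scaled_commutator a b c -> scaled_commutator b a (- c).
Proof.
move=> abc h; rewrite (starhomN (phi_starhom A h)) abc -scalerN.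
by rewrite /commutator opprB.
Qed.

Lemma scaled_commutator_linl (k : R[i]) a a' b c c' :
  scaled_commutator a b c -> scaled_commutator a' b c' ->
  scaled_commutator (k *: a + a') b (k *: c + c').
Proof.
move=> abc abc' h; rewrite !(sh_linear (phi_starhom A h)) abc abc'.
set t := _ / _; rewrite scalerA (mulrC k) -scalerA -scalerDr.
rewrite -commutatorZl; congr (_ *: _).
by rewrite /commutator csDl csDr opprD addrACA.
Qed.

Lemma scaled_commutator_linr (k : R[i]) a b b' c c' :
  scaled_commutator a b c -> scaled_commutator a b' c' ->
  scaled_commutator a (k *: b + b') (k *: c + c').
Proof.
move=> /scaled_commutator_sym abc /scaled_commutator_sym abc'.
have := scaled_commutator_sym (scaled_commutator_linl k abc abc').
by rewrite scalerN -opprD opprK.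
Qed.

Lemma scaled_commutator_leibniz x y z p q :
  scaled_commutator x y p -> scaled_commutator x z q ->
  scaled_commutator x (y ** z) (p ** z + y ** q).
Proof.
move=> xyp xzq h; have hP := phi_starhom A h.
rewrite (starhomD hP) !(sh_mul hP) xyp xzq csZl csZr -scalerDr.
by rewrite /commutator csBl csBr !csA addrA subrK.
Qed.

Lemma scaled_commutator_jacobi x y z u v w p q r :
  scaled_commutator y z u -> scaled_commutator x u p ->
  scaled_commutator z x v -> scaled_commutator y v q ->
  scaled_commutator x y w -> scaled_commutator z w r -> p + q + r = 0.
Proof.
move=> yzu xup zxv yvq xyw zwr; apply: sec_eq => h.
have hP := phi_starhom A h; rewrite !(starhomD hP) (starhom0 hP).
rewrite xup yvq zwr yzu zxv xyw !commutatorZr -!scalerDr.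
set X := phi A h x; set Y := phi A h y; set Z := phi A h z.
suff -> : commutator X (commutator Y Z) + commutator Y (commutator Z X) +
    commutator Z (commutator X Y) = 0 by rewrite !scaler0.
rewrite /commutator !csBl !csBr !csA !opprB !addrA.
rewrite [LHS](ACl (1*12*2*7*3*10*4*5*6*11*8*9)%AC) /=.
by rewrite !(subrr, addNr, add0r).
Qed.

(** At each h the bracket with b is i/|h| times a derivation to which the
    interpolation inequality applies, so that
    s |{a, b}| <= 2 |a| + s^2 |{{a, b}, b}| for every s >= 0, in each fibre.
    The double bracket is bounded uniformly in h. *)
Lemma scaled_commutator_ideal_sa a b c d : b^† = b ->
  scaled_commutator a b c -> scaled_commutator c b d ->
  minext_set (zeroI I) a -> minext_set (zeroI I) c.
Proof.
move=> bsa /scaled_commutatorP abc /scaled_commutatorP cbd /minext0P a0.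
have FI := at0_filter I.
have ineq s h : 0 <= s -> s * rnorm (phi A h c) <=
    2 * rnorm (phi A h a) + s ^+ 2 * rnorm (phi A h d).
  move=> s0; have ia := absI_gt0 h.
  pose t := s / absI h; have t0 : 0 <= t by rewrite divr_ge0// ltW.
  have := @rnorm_comm_interpolation _ _ (t%:C *: phi A h b) (phi A h a).
  rewrite starZr -(sh_star (phi_starhom A h)) bsa => /(_ erefl).
  rewrite !commutatorZr !commutatorZl scalerA -rmorphM !rnormZr.
  rewrite cbd abc !commutatorZl !rnormZr !rnormZi !rnormZr !rnormZi.
  rewrite !ger0_norm ?mulr_ge0 ?invr_ge0 ?(ltW ia)//.
  by move=> H; apply: etrans _ H; rewrite /t; congr (_ <= _ + _); ring.
apply/minext0P => e e0.
have d1 : 0 < rnorm d + 1 by rewrite ltr_wpDl ?rnorm_ge0.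
(* With this s the double bracket contributes at most s e / 2. *)
pose s := e / (2 * (rnorm d + 1)).
have s0 : 0 < s by rewrite divr_gt0// mulr_gt0.
have se : s * (rnorm d + 1) = e / 2.
  by rewrite /s; field; rewrite gt_eqF.
have se0 : 0 < s * e / 4 by have := mulr_gt0 s0 e0; lra.
apply: filterS (a0 _ se0) => h ah; rewrite -(ltr_pM2l s0).
have := ineq s h (ltW s0); have := rnorm_phi_le d h; nra.
Qed.

End scaled_commutator.

(** * Poisson brackets *)

Section poisson.
Variables (R : realType) (A : pqBundle R).
Implicit Types (a b c : pq_sec A) (x y z : pq_lim A).

Local Notation P := (pq_P A).
Local Notation K := (minext_ideal (pq_bundle A) (zeroI (pq_base A))).

(** Real and imaginary parts reduce the claim to self-adjoint b; this is where
    closure of the dense subalgebra under the involution enters. *)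
Lemma scaled_commutator_ideal a b c : P a -> P b ->
  scaled_commutator a b c -> K a -> K c.
Proof.
move=> Pa Pb abc Ka; have PA := pq_subalg A.
have sa b' c' : P b' -> b'^† = b' -> scaled_commutator a b' c' -> K c'.
  move=> Pb' b'sa abc'; have [c1 Pc1 abc1] := pq_bracket Pa Pb'.
  rewrite (scaled_commutator_inj abc' abc1).
  have [d _ cbd] := pq_bracket Pc1 Pb'.
  exact: scaled_commutator_ideal_sa b'sa abc1 cbd Ka.
have Pb1 : P (b + b^†) by apply: (ssaD PA) => //; exact: (ssa_star PA).
have Pb2 : P ('i *: (b^† - b)).
  apply: (ssaZ PA); apply: (ssaD PA); first exact: (ssa_star PA).
  by rewrite -scaleN1r; exact: (ssaZ PA).
have [c1 _ abc1] := pq_bracket Pa Pb1; have [c2 _ abc2] := pq_bracket Pa Pb2.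
have K1 : K c1 by apply: sa abc1 => //; rewrite starD starK addrC.
have K2 : K c2.
  by apply: sa abc2 => //; rewrite starZi starB starK -scalerN opprB.
have := scaled_commutator_linr 'i abc2 abc1.
rewrite scaleii opprB [b + _]addrC addrA subrK -[X in X + b]scale1r.
move=> /(scaled_commutator_inj (scaled_commutator_linr 1 abc abc)).
rewrite scale1r => cc.
have -> : c = 2^-1%:C *: (c + c).
  rewrite scalerDr -scalerDl -rmorphD.
  by rewrite (_ : 2^-1 + 2^-1 = 1 :> R) ?scale1r//; field.
by rewrite cc; apply: ciZ; apply: ciD K1; exact: ciZ.
Qed.

Lemma pq_phi0_eq a b : pq_phi0 a = pq_phi0 b <-> K (a - b).
Proof. exact: qpi_eq. Qed.

Lemma pq_phi0_surj x : exists a, pq_phi0 a = x.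
Proof. exact: phi0_surj. Qed.

Lemma pq_phi0_starhom : is_starhom (@pq_phi0 R A).
Proof. exact: phi0_starhom. Qed.

(** The bracket is additive in each argument, so independence of the
    representatives is the vanishing of the bracket on the ideal. *)
Lemma poissonE a b c : P a -> P b -> P c -> scaled_commutator a b c ->
  poisson (pq_phi0 a) (pq_phi0 b) = pq_phi0 c.
Proof.
move=> Pa Pb Pc abc; have PA := pq_subalg A.
have PN a1 a2 : P a1 -> P a2 -> P ((-1) *: a2 + a1).
  by move=> P1 P2; apply: (ssaD PA) => //; exact: (ssaZ PA).
rewrite /poisson; set S := (X in xget 0 X).
have [a' [b' [c' [Pa' Pb' Pc' abc' [aa bb <-]]]]] : S (xget 0 S).
  by apply: xgetPex; exists (pq_phi0 c), a, b, c.
apply/esym.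
have [d Pd abd] := pq_bracket Pa' Pb; apply: (@eq_trans _ _ (pq_phi0 d)).
  apply/pq_phi0_eq; rewrite addrC -scaleN1r.
  apply: scaled_commutator_ideal (scaled_commutator_linl (-1) abd abc) _ => //.
    exact: PN.
  by rewrite scaleN1r addrC; apply/pq_phi0_eq.
apply/pq_phi0_eq; rewrite addrC -scaleN1r -[_ + _]opprK; apply: closed_idealN.
apply: scaled_commutator_ideal
  (scaled_commutator_sym (scaled_commutator_linr (-1) abc' abd)) _ => //.
  exact: PN.
by rewrite scaleN1r addrC; apply/pq_phi0_eq.
Qed.

Lemma pq_commutator_ideal a b : K (commutator a b).
Proof.
apply/minext0P => e e0; have FI := at0_filter (pq_base A).
have e0' : 0 < e%:C by rewrite ltcR.
have /cvgrPdist_lt/(_ _ e0') := pq_comm a b; apply: filterS => h.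
rewrite sub0r normrN normr_id -rnormE ltcR.
by rewrite (starhom_comm (phi_starhom (pq_bundle A) h)).
Qed.

(** The Lie and Leibniz identities hold for scaled commutators in every fibre
    and pass to the limit; commutativity is the vanishing of commutators at the
    added point. *)
Lemma LP_class_object : is_class_object (LP_ob A).
Proof.
have PA := pq_subalg A; have hom := pq_phi0_starhom.
split => /=.
- exact: Lim_cstar.
- move=> x y; have [a <-] := pq_phi0_surj x; have [b <-] := pq_phi0_surj y.
  rewrite -[LHS](sh_mul hom) -[RHS](sh_mul hom); apply/pq_phi0_eq.
  exact: pq_commutator_ideal.
- move=> O [x Ox] oO; have [a ax] := pq_phi0_surj x.
  have /nbhs_ballP[_ /complex_gt0E[e e0 ->] eO] := open_nbhs_nbhs (conj oO Ox).
  have := @pq_dense _ A (ball a e%:C)^°.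
  case; [|exact: open_interior|].
    by exists a; apply: nbhsx_ballx; rewrite ltcR.
  move=> p [/interior_subset ap Pp]; exists (pq_phi0 p).
  split; last by exists p.
  apply: eO; rewrite ball_rnorm -ax -(starhomB hom).
  by apply: le_lt_trans (rnorm_qpi_le _ _) _; rewrite -ball_rnorm.
- by exists 0; [exact: (ssa0 PA)|exact: (starhom0 hom)].
- move=> _ _ [a Pa <-] [b Pb <-]; exists (a + b); first exact: (ssaD PA).
  exact: (starhomD hom).
- move=> k _ [a Pa <-]; exists (k *: a); first exact: (ssaZ PA).
  exact: (starhomZ hom).
- move=> _ _ [a Pa <-] [b Pb <-]; exists (a ** b); first exact: (ssaM PA).
  exact: (sh_mul hom).
- move=> _ _ [a Pa <-] [b Pb <-]; have [c Pc abc] := pq_bracket Pa Pb.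
  by exists c => //; rewrite (poissonE Pa Pb Pc abc).
- move=> k _ _ _ [a Pa <-] [b Pb <-] [c Pc <-].
  have [p Pp acp] := pq_bracket Pa Pc; have [q Pq bcq] := pq_bracket Pb Pc.
  rewrite (poissonE Pa Pc Pp acp) (poissonE Pb Pc Pq bcq).
  rewrite -!(sh_linear hom).
  apply: poissonE (scaled_commutator_linl k acp bcq) => //;
    by apply: (ssaD PA) => //; exact: (ssaZ PA).
- move=> _ _ [a Pa <-] [b Pb <-]; have [p Pp abp] := pq_bracket Pa Pb.
  rewrite (poissonE Pa Pb Pp abp) -[p]opprK (starhomN hom); congr (- _).
  apply/esym/poissonE => //; last exact: scaled_commutator_sym.
  by rewrite -scaleN1r; exact: (ssaZ PA).
- move=> _ _ _ [a Pa <-] [b Pb <-] [c Pc <-].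
  have [u Pu bcu] := pq_bracket Pb Pc; have [p Pp aup] := pq_bracket Pa Pu.
  have [v Pv cav] := pq_bracket Pc Pa; have [q Pq bvq] := pq_bracket Pb Pv.
  have [w Pw abw] := pq_bracket Pa Pb; have [r Pr cwr] := pq_bracket Pc Pw.
  rewrite (poissonE Pb Pc Pu bcu) (poissonE Pa Pu Pp aup).
  rewrite (poissonE Pc Pa Pv cav) (poissonE Pb Pv Pq bvq).
  rewrite (poissonE Pa Pb Pw abw) (poissonE Pc Pw Pr cwr).
  rewrite -(starhomD hom p q) -(starhomD hom (p + q) r).
  by rewrite (scaled_commutator_jacobi bcu aup cav bvq abw cwr) (starhom0 hom).
- move=> _ _ _ [a Pa <-] [b Pb <-] [c Pc <-].
  have [p Pp abp] := pq_bracket Pa Pb; have [q Pq acq] := pq_bracket Pa Pc.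
  rewrite (poissonE Pa Pb Pp abp) (poissonE Pa Pc Pq acq).
  rewrite -[X in poisson _ X](sh_mul hom b c).
  rewrite -[X in _ = X + _](sh_mul hom p c) -[X in _ = _ + X](sh_mul hom b q).
  rewrite -(starhomD hom (p ** c) (b ** q)).
  apply: poissonE (scaled_commutator_leibniz abp acq) => //.
    exact: (ssaM PA).
  by apply: (ssaD PA); exact: (ssaM PA).
Qed.

End poisson.

(** * Morphisms *)

(** The norm functions converge at the added point, hence their limits can be
    computed along any proper map into the base. *)
Lemma minext0_proper (R : realType) (I J : I1space R) (B : ucb_bundle J)
    (alpha : I -> J) (b : sec B) : proper_map alpha ->
  (forall e : R, 0 < e ->
     \forall h \near at0 I, rnorm (phi B (alpha h) b) < e) ->
  minext_set (zeroI J) b.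
Proof.
move=> pa ab; apply/minext0P => e e0; have FI := at0_filter I.
have e20 : 0 < e / 2 by rewrite divr_gt0.
have [d d0 bd] := rnorm_phi_cauchy b e20.
have near_alpha : \forall h \near at0 I, absI (alpha h) < d.
  exact: proper_at0 pa _ (C1_dist_cvg J d0).
have [h [hd hb]] := filter_ex (filterI near_alpha (ab _ e20)).
by apply/at0P; exists d => // j jd; have := bd j (alpha h) jd hd; lra.
Qed.

Section morphism.
Variables (R : realType) (A B : pqBundle R) (s : pq_hom A B).
Implicit Types (a b c : pq_sec A).

Local Notation alpha := (sval s).1.
Local Notation beta := (sval s).2.
Local Notation phiA := (phi (pq_bundle A)).
Local Notation phiB := (phi (pq_bundle B)).

(** The fibre maps induced by a bundle homomorphism are *-homomorphisms, hence
    contractive. *)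
Lemma rnorm_bundle_hom_le a h :
  rnorm (phiB (alpha h) (beta a)) <= rnorm (phiA h a).
Proof.
have [[_ bhom bc] _ _ _] := svalP s.
apply: (@starhom_factor_le _ _ _ _ (phiA h) (phiB (alpha h) \o beta)) => /=.
- exact: phi_starhom.
- exact: starhom_comp (phi_starhom _ _) bhom.
- exact: phi_surj.
- by move=> x y; exact: bc.
Qed.

Lemma pq_phi0_beta a b : pq_phi0 a = pq_phi0 b ->
  pq_phi0 (beta a) = pq_phi0 (beta b).
Proof.
have [[_ bhom _] pa _ _] := svalP s => /phi0_eq ab.
apply/pq_phi0_eq/(minext0_proper pa) => e e0.
rewrite -(starhomB bhom); have FI := at0_filter (pq_base A).
by apply: filterS (ab e e0) => h; apply: le_lt_trans; exact: rnorm_bundle_hom_le.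
Qed.

Lemma LP_morE a : LP_mor s (pq_phi0 a) = pq_phi0 (beta a).
Proof.
rewrite /LP_mor /lim_map; set S := (X in xget 0 X).
have [b [ba <-]] : S (xget 0 S).
  by apply: xgetPex; exists (pq_phi0 (beta a)), a.
exact: pq_phi0_beta.
Qed.

(** In the fibre over alpha h, the image of the bracket and the bracket of the
    images are the same commutator with factors 1/|h| and 1/|alpha h|. The
    second-order condition keeps the difference of these factors bounded, while
    the commutator tends to 0. *)
Lemma pq_phi0_bracket a b c (c' : pq_sec B) : scaled_commutator a b c ->
  scaled_commutator (beta a) (beta b) c' -> pq_phi0 (beta c) = pq_phi0 c'.
Proof.
have [[_ bhom bc] pa _ [k k0 so]] := svalP s.
move=> /scaled_commutatorP abc /scaled_commutatorP abc'.
have FI := at0_filter (pq_base A).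
apply/pq_phi0_eq/(minext0_proper pa) => e e0.
have k1 : 0 < k + 1 by lra.
have ek : 0 < e / (k + 1) by rewrite divr_gt0.
have /phi0_eq comm0 : pq_phi0 (commutator a b) = pq_phi0 0.
  by apply/pq_phi0_eq; rewrite subr0; exact: pq_commutator_ideal.
have /cvgrPdist_lt/(_ _ ltr01) := so.
move: (comm0 _ ek); apply: filterS2 => h; rewrite subr0 => hc hk.
set t := (absI h)^-1 in hk; set t' := (absI (alpha h))^-1 in hk.
have cE : phiB (alpha h) (beta c) =
    t%:C *: ('i *: phiB (alpha h) (beta (commutator a b))).
  rewrite -!(starhomZ (phi_starhom _ _)) -!(starhomZ bhom); apply: bc.
  by rewrite !(starhomZ (phi_starhom _ _)) (starhom_comm (phi_starhom _ _)).
rewrite (starhomB (phi_starhom _ _)) cE abc'.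
rewrite -(starhom_comm (phi_starhom _ _)) -(starhom_comm bhom) -scalerBl.
rewrite -rmorphB rnormZr rnormZi.
rewrite ltr_pdivlMr// in hc.
have := rnorm_bundle_hom_le (commutator a b) h.
have := rnorm_ge0 (phiB (alpha h) (beta (commutator a b))).
have : `|t - t'| <= k + 1.
  by move: hk; rewrite ltr_distl => /andP[hk _]; lra.
have := normr_ge0 (t - t'); nra.
Qed.

Lemma LP_class_morphism : @is_class_morphism R (LP_ob A) (LP_ob B) (LP_mor s).
Proof.
have [[_ bhom _] _ sm _] := svalP s.
have homA := pq_phi0_starhom A; have homB := pq_phi0_starhom B.
split => /=.
- split=> [k x y|x y|x]; have [a <-] := pq_phi0_surj x.
  + have [b <-] := pq_phi0_surj y.
    by rewrite -(sh_linear homA) !LP_morE (sh_linear bhom) (sh_linear homB).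
  + have [b <-] := pq_phi0_surj y.
    by rewrite -(sh_mul homA a b) !LP_morE (sh_mul bhom) (sh_mul homB).
  + by rewrite -(sh_star homA a) !LP_morE (sh_star bhom) (sh_star homB).
- by move=> _ [a Pa <-]; exists (beta a); [exact: sm|rewrite LP_morE].
move=> _ _ [a Pa <-] [b Pb <-]; rewrite !LP_morE.
have [c Pc abc] := pq_bracket Pa Pb.
have [c' Pc' abc'] := pq_bracket (sm _ Pa) (sm _ Pb).
rewrite (poissonE Pa Pb Pc abc) (poissonE (sm _ Pa) (sm _ Pb) Pc' abc').
by rewrite LP_morE (pq_phi0_bracket abc abc').
Qed.

End morphism.

Theorem proposition5p5 (R : realType) :
  [/\ forall (A : pqBundle R) (a b c : pq_sec A),
        pq_P A a -> pq_P A b -> pq_P A c -> scaled_commutator a b c ->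
        poisson (pq_phi0 a) (pq_phi0 b) = pq_phi0 c,
      forall (A B : pqBundle R) (s : pq_hom A B) (a : pq_sec A),
        LP_mor s (pq_phi0 a) = pq_phi0 ((sval s).2 a),
      forall (A B : pqBundle R) (s : pq_hom A B),
        @is_class_morphism R (LP_ob A) (LP_ob B) (LP_mor s) &
      exists (Ho : forall A : pqBundle R, is_class_object (LP_ob A))
             (Hm : forall (A B : pqBundle R) (s : pq_hom A B),
                @is_class_morphism R (LP_ob A) (LP_ob B) (LP_mor s)),
        @is_functor (PQBun R) (Class R)
          (fun A => exist _ (LP_ob A) (Ho A))
          (fun A B s => exist _ (LP_mor s) (Hm A B s))].
Proof.
split; [exact: poissonE|exact: LP_morE|exact: LP_class_morphism|].
exists (@LP_class_object R), (@LP_class_morphism R).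
split=> [A|A B C t s]; apply: eq_exist; apply/funext => x;
  have [a <-] := pq_phi0_surj x.
- by rewrite LP_morE.
- by rewrite /= !LP_morE.
Qed.
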